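(* Let $X\in\mathbf{Top}$. Then there are maps $\|\Lambda_\bullet X\|_1\to G_2(X)$ and $G_2(X)\to\|\Lambda_\bullet X\|_1$ which are maps over $X$ up to homotopy. That is, the composite $\|\Lambda_\bullet X\|_1\to G_2(X)\xrightarrow{p_2}X$ is homotopic to the canonical map $\|\Lambda_\bullet X\|_1\to X$, and the composite $G_2(X)\to\|\Lambda_\bullet X\|_1\to X$ of the second map with the canonical map is homotopic to $p_2$.
   Context: $\mathbf{Top}$ is the category of well-pointed compactly generated spaces having the homotopy type of CW-complexes; maps and homotopies are base-point preserving. $\Omega$ and $\Sigma$ are the loop space and reduced suspension functors, and $\mathrm{ev}_X\colon\Sigma\Omega X\to X$, $[\omega,s]\mapsto\omega(s)$, is the evaluation map. Ganea fibrations: $p_1\colon G_1(X)\to X$ is the fibration associated to $\mathrm{ev}_X\colon\Sigma\Omega X\to X$. Given $p_n\colon G_n(X)\to X$ with homotopy fiber $F_n(X)$, let $G_n(X)\cup\mathcal{C}(F_n(X))$ be the mapping cone (with reduced cone $\mathcal C$) of $F_n(X)\to G_n(X)$ and let $p'_{n+1}\colon G_n(X)\cup\mathcal C(F_n(X))\to X$ be $p_n$ on $G_n(X)$ and constant at the base point on the cone; $p_{n+1}\colon G_{n+1}(X)\to X$ is the fibration associated to $p'_{n+1}$. A facial space $X_\bullet$ is a sequence of spaces $X_0,X_1,\dots$ in $\mathbf{Top}$ with maps $d_i\colon X_n\to X_{n-1}$ ($0\le i\le n$) such that $d_id_j=d_{j-1}d_i$ for $i<j$. A facial resolution $X_\bullet\to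 X$ is a facial space together with an augmentation $d_0\colon X_0\to X$ satisfying $d_0d_0=d_0d_1$ on $X_1$. Realization: let $\Delta^n$ be the standard $n$-simplex, $\delta^i$ the inclusions of its faces, and $X\rtimes Y=X\times Y/( *\times Y)$. Set $\|X_\bullet\|_0=X_0$ with $\chi_0\colon X_0\rtimes\Delta^0\to X_0$ the obvious homeomorphism. Inductively, $\|X_\bullet\|_n$ and $\chi_n\colon X_n\rtimes\Delta^n\to\|X_\bullet\|_n$ are defined by the pushout of $X_n\rtimes\Delta^n\hookleftarrow X_n\rtimes\partial\Delta^n\xrightarrow{\varphi_n}\|X_\bullet\|_{n-1}$, where $\varphi_n\circ(X_n\rtimes\delta^i)=\chi_{n-1}\circ(d_i\rtimes\Delta^{n-1})$ for $0\le i\le n$. For a facial resolution $X_\bullet\to X$, the canonical map $\|X_\bullet\|_n\to X$ is the augmentation for $n=0$; for $n\geq 1$ it is the unique map extending the canonical map on $\|X_\bullet\|_{n-1}$ whose composite with $\chi_n$ is $X_n\rtimes\Delta^n\xrightarrow{\mathrm{pr}}X_n\xrightarrow{(d_0)^{n+1}}X$. $\Lambda_\bullet X\to X$ is the facial resolution with $\Lambda_nX=(\Sigma\Omega)^{n+1}X$, face operators $d_i=(\Sigma\Omega)^i(\mathrm{ev}_{(\Sigma\Omega)^{n-i}X})\colon(\Sigma\Omega)^{n+1}X\to(\Sigma\Omega)^nX$, and augmentation $d_0=\mathrm{ev}_X\colon\Sigma\Omega X\to X$. *)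

(* Defs.v *)
From HB Require Import structures.
From Stdlib Require Import Relation_Operators.
From mathcomp Require Import all_boot all_order all_algebra generic_quotient.
From mathcomp Require Import all_classical reals topology homotopy normedtype.

Set Implicit Arguments.
Unset Strict Implicit.
Unset Printing Implicit Defensive.

Import Order.TTheory GRing.Theory Num.Theory.
Import numFieldTopology.Exports.
Import numFieldNormedType.Exports.

Local Open Scope classical_set_scope.
Local Open Scope ring_scope.
Local Open Scope quotient_scope.

Lemma comp_continuous (X Y Z : topologicalType) (g : Y -> Z) (f : X -> Y) :
  continuous g -> continuous f -> continuous (g \o f).
Proof. by move=> cg cf x; exact: (continuous_comp (cf x) (cg (f x))). Qed.

Lemma fst_continuous (A B : topologicalType) : continuous (@fst A B).
Proof. by move=> p; exact: cvg_fst. Qed.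

Lemma snd_continuous (A B : topologicalType) : continuous (@snd A B).
Proof. by move=> p; exact: cvg_snd. Qed.

(** * Pointed maps *)

Record ptmap (X Y : ptopologicalType) := PtMap {
  ptmap_fun :> X -> Y;
  ptmap_continuous : continuous ptmap_fun;
  ptmap_point : ptmap_fun point = point
}.

Arguments ptmap_continuous {X Y} p x.

Fact ptcomp_continuous (X Y Z : ptopologicalType) (g : ptmap Y Z) (f : ptmap X Y) :
  continuous (g \o f).
Proof. by apply: comp_continuous; exact: ptmap_continuous. Qed.

Fact ptcomp_point (X Y Z : ptopologicalType) (g : ptmap Y Z) (f : ptmap X Y) :
  (g \o f) point = point.
Proof. by rewrite /= !ptmap_point. Qed.

Definition ptcomp (X Y Z : ptopologicalType) (g : ptmap Y Z) (f : ptmap X Y) :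
  ptmap X Z := PtMap (@ptcomp_continuous X Y Z g f) (ptcomp_point g f).

(** * The unit interval and homotopies *)

Definition unit_interval (R : realType) : Type := [set` `[0 : R, 1]].

Section unit_interval.
Variable R : realType.
Notation I := (unit_interval R).

HB.instance Definition _ := Topological.copy I (set_type [set` `[0 : R, 1]]).

Fact unit_interval0_subproof : (0 : R) \in [set` `[0 : R, 1]].
Proof. by rewrite inE /= bound_itvE. Qed.
Fact unit_interval1_subproof : (1 : R) \in [set` `[0 : R, 1]].
Proof. by rewrite inE /= bound_itvE. Qed.

Let I0 : I := exist _ 0 unit_interval0_subproof.
Let I1 : I := exist _ 1 unit_interval1_subproof.

Fact unit_interval_neq_subproof : I0 != I1.
Proof. by apply/eqP => /(congr1 val) /= /esym/eqP; rewrite oner_eq0. Qed.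

HB.instance Definition _ :=
  @isBiPointed.Build I I0 I1 unit_interval_neq_subproof.

Lemma unit_interval_regular : @regular_space I.
Proof. exact: (@uniform_regular (set_type [set` `[0 : R, 1]])). Qed.

Lemma unit_interval_compact : compact [set: I].
Proof.
move=> F FF _; pose v : I -> R := \val.
have FvI : (v @ F) [set` `[0 : R, 1]].
  change (F (v @^-1` [set` `[0 : R, 1]])).
  by apply: filterS (filterT : F setT) => t _; exact: (set_mem (valP t)).
have [p [pI clp]] := @segment_compact R 0 1 (v @ F) _ FvI.
have pI' : p \in [set` `[0 : R, 1]] by rewrite inE.
exists (exist _ p pI' : I); split=> // A B FA [_ [[C oC <-] /= Cp CB]].
have [_ [[t At <-] Ct]] : (v @` A) `&` C !=set0.
  apply: clp; last exact: open_nbhs_nbhs.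
  change (F (v @^-1` (v @` A))).
  by apply: filterS FA => t At; exists t.
by exists t; split=> //; exact: CB.
Qed.

Lemma unit_interval_locally_compact : locally_compact [set: I].
Proof.
move=> t _; rewrite withinET; exists setT; first exact: filterT.
by split; [exact: unit_interval_compact | exact: closedT].
Qed.

Lemma path_eval_continuous (S X : topologicalType)
    (f : S -> {compact-open, I -> X}) :
  continuous f -> (forall s, continuous (f s : I -> X)) ->
  continuous (fun p : S * I => f p.1 p.2).
Proof.
move=> cf cfs; rewrite (_ : (fun _ => _) = uncurry (f : S -> I -> X)).
  apply: continuous_uncurry_regular => //.
    exact: unit_interval_locally_compact.
  exact: unit_interval_regular.
by apply/funext => -[].
Qed.

Lemma path_eval1_continuous (S X : topologicalType) (t : I)
    (f : S -> {compact-open, I -> X}) :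
  continuous f -> (forall s, continuous (f s : I -> X)) ->
  continuous (fun s => f s t).
Proof.
move=> cf cfs s.
have pt : continuous (fun s : S => (s, t)).
  move=> s'; apply: (@cvg_pair _ _ _ (nbhs s') (nbhs s') (nbhs t)); last first.
    exact: cvg_cst.
  exact: cvg_id.
have ec := path_eval_continuous cf cfs.
exact: (continuous_comp (pt s) (ec (s, t))).
Qed.

Lemma postcomp_continuous (X Y : topologicalType) (h : X -> Y) :
  continuous h ->
  continuous (fun w : {compact-open, I -> X} =>
    (h \o w : {compact-open, I -> Y})).
Proof.
move=> ch w; apply/compact_open_cvgP.
  by apply: fmap_filter; exact: nbhs_filter.
move=> K O cK oO hwK.
have oP : open (h @^-1` O) by apply: open_comp => // x _; exact: ch.
have wK : w @` K `<=` h @^-1` O.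
  by move=> _ [t Kt <-]; apply: hwK; exists t.
have := open_nbhs_nbhs (conj (compact_open_open cK oP) wK).
apply: filterS => g gK _ [t Kt <-]; apply: gK; by exists t.
Qed.

(** Homotopies of pointed maps are base-point preserving; [free_homotopic] is
    the unpointed notion, used only to say "homotopy type". *)
Definition homotopic (X Y : ptopologicalType) (f g : ptmap X Y) : Prop :=
  exists H : X * I -> Y,
    [/\ continuous H, forall x, H (x, zero) = f x, forall x, H (x, one) = g x
      & forall t, H (point, t) = point].

Definition free_homotopic (X Y : topologicalType) (f g : X -> Y) : Prop :=
  exists H : X * I -> Y,
    [/\ continuous H, forall x, H (x, zero) = f x & forall x, H (x, one) = g x].

Definition homotopy_equivalent (X Y : topologicalType) : Prop :=
  exists (f : X -> Y) (g : Y -> X),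
    [/\ continuous f, continuous g, free_homotopic (g \o f) idfun
      & free_homotopic (f \o g) idfun].

End unit_interval.

(** * Compactly generated spaces *)

Definition k_open (T : topologicalType) (U : set T) : Prop :=
  forall (K : topologicalType) (u : K -> T), compact [set: K] ->
    hausdorff_space K -> continuous u -> open (u @^-1` U).

Definition k_space (T : topologicalType) : Prop :=
  forall U : set T, k_open U -> open U.

Definition weak_hausdorff (T : topologicalType) : Prop :=
  forall (K : topologicalType) (u : K -> T), compact [set: K] ->
    hausdorff_space K -> continuous u -> closed (range u).

Definition compactly_generated (T : topologicalType) : Prop :=
  k_space T /\ weak_hausdorff T.

(** The k-ification of [T]. Limits of compactly generated spaces are the
    k-ifications of the topological limits, and mapping spaces are the
    k-ifications of the compact-open topology. Quotients, and products with a
    compact Hausdorff factor, need no k-ification. *)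
Definition kify (T : topologicalType) : Type := T.

Section kify.
Variable T : topologicalType.

Fact k_openT : k_open [set: T].
Proof. by move=> K u _ _ _; rewrite preimage_setT; exact: openT. Qed.

Fact k_openI : setI_closed (@k_open T).
Proof.
move=> U V kU kV K u cK hK cu; rewrite preimage_setI.
by apply: openI; [exact: kU | exact: kV].
Qed.

Fact k_open_bigU (I : Type) (U : I -> set T) :
  (forall i, k_open (U i)) -> k_open (\bigcup_i U i).
Proof.
move=> kU K u cK hK cu; rewrite preimage_bigcup.
by apply: bigcup_open => i _; exact: kU.
Qed.

HB.instance Definition _ := Choice.copy (kify T) T.
HB.instance Definition _ :=
  isOpenTopological.Build (kify T) k_openT k_openI k_open_bigU.

Lemma kify_openE (U : set T) : open (U : set (kify T)) = k_open U.
Proof. by []. Qed.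

Lemma kify_id_continuous : continuous (idfun : kify T -> T).
Proof.
apply/continuousP => U oU; rewrite kify_openE => K u _ _ cu.
by apply: open_comp => // x _; exact: cu.
Qed.
End kify.

HB.instance Definition _ (T : ptopologicalType) :=
  isPointed.Build (kify T) (point : T).

Lemma kify_map_continuous (S T : topologicalType) (f : S -> T) :
  continuous f -> continuous (f : kify S -> kify T).
Proof.
move=> cf; apply/continuousP => U.
rewrite kify_openE => kU; rewrite kify_openE => K u cK hK cu.
by apply: (kU K (f \o u)) => //; exact: comp_continuous.
Qed.

(** * The category Top *)

(** The homotopy extension property of the inclusion of the base point. In a
    weak Hausdorff space the base point is closed. *)
Definition well_pointed (R : realType) (X : ptopologicalType) : Prop :=
  forall (Y : topologicalType) (f : X -> Y) (w : unit_interval R -> Y),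
    continuous f -> continuous w -> w zero = f point ->
    exists H : X * unit_interval R -> Y,
      [/\ continuous H, forall x, H (x, zero) = f x
        & forall t, H (point, t) = w t].

Section CW.
Variable R : realType.

Definition sqnorm n (x : 'rV[R]_n) : R := \sum_i x ord0 i ^+ 2.

Definition disk n : set 'rV[R]_n := [set x | sqnorm x <= 1].
Arguments disk : clear implicits.

(** A CW-complex structure in Whitehead's sense, given by characteristic maps
    of the cells. *)
Record CW_structure (Y : topologicalType) := CWStructure {
  cw_cell : nat -> Type;
  cw_char : forall n, cw_cell n -> disk n -> Y;
  cw_hausdorff : hausdorff_space Y;
  cw_char_continuous : forall n (e : cw_cell n), continuous (cw_char e);
  cw_partition : forall y, exists! c : {n & (cw_cell n * disk n)%type},
    sqnorm (\val (projT2 c).2) < 1 /\ cw_char (projT2 c).1 (projT2 c).2 = y;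
  cw_closure_finite : forall n (e : cw_cell n),
    exists S : set {m & cw_cell m},
      [/\ finite_set S, forall c, S c -> (projT1 c < n)%N
        & forall x : disk n, sqnorm (\val x) = 1 ->
            exists2 c, S c & exists2 z : disk (projT1 c),
              sqnorm (\val z) < 1 & cw_char (projT2 c) z = cw_char e x];
  cw_weak : forall A : set Y,
    (forall n (e : cw_cell n), closed (cw_char e @^-1` A)) -> closed A
}.

Definition CW_homotopy_type (X : topologicalType) : Prop :=
  exists Y : topologicalType,
    inhabited (CW_structure Y) /\ homotopy_equivalent R X Y.

Definition in_Top (X : ptopologicalType) : Prop :=
  [/\ well_pointed R X, compactly_generated X & CW_homotopy_type X].

End CW.

(** * Quotients and gluing *)

Section quotient.
Variables (T : ptopologicalType) (r : T -> T -> Prop).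

Definition gen_rel : rel T := fun x y => `[< clos_refl_sym_trans T r x y >].

Fact gen_rel_refl : reflexive gen_rel.
Proof. by move=> x; apply/asboolP; exact: rst_refl. Qed.
Fact gen_rel_sym : symmetric gen_rel.
Proof. by move=> x y; apply/asboolP/asboolP; exact: rst_sym. Qed.
Fact gen_rel_trans : transitive gen_rel.
Proof.
by move=> y x z /asboolP xy /asboolP yz; apply/asboolP/(rst_trans _ _ _ _ _ xy).
Qed.

Definition gen_equiv := EquivRel gen_rel gen_rel_refl gen_rel_sym gen_rel_trans.

(** The quotient of [T] by the equivalence relation generated by [r]. *)
Definition quo : ptopologicalType := quotient_topology {eq_quot gen_equiv}.

Definition quo_pi (x : T) : quo :=
  \pi_(quotient_topology {eq_quot gen_equiv}) x.

Lemma quo_pi_continuous : continuous quo_pi.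
Proof. exact: pi_continuous. Qed.

Lemma quo_piP x y : r x y -> quo_pi x = quo_pi y.
Proof. by move=> rxy; apply/eqmodP/asboolP; exact: rst_step. Qed.

Lemma quo_surj (q : quo) : exists x, q = quo_pi x.
Proof. by exists (repr q); rewrite /quo_pi reprK. Qed.

Definition qpi : ptmap T quo := @PtMap T quo quo_pi quo_pi_continuous erefl.

Section lift.
Variables (Z : ptopologicalType) (f : ptmap T Z).
Hypothesis fr : forall x y, r x y -> f x = f y.

Definition quo_lift_fun : quo -> Z :=
  f \o (repr : quotient_topology {eq_quot gen_equiv} -> T).

Fact quo_lift_homo x y : quo_pi x = quo_pi y -> f x = f y.
Proof.
by move=> /eqmodP/asboolP; elim=> // ? ? ? _ -> _ ->.
Qed.

Fact quo_lift_funE x : quo_lift_fun (quo_pi x) = f x.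
Proof. by apply: quo_lift_homo; rewrite /quo_pi reprK. Qed.

Fact quo_lift_continuous : continuous quo_lift_fun.
Proof.
apply: repr_comp_continuous; first exact: ptmap_continuous.
by move=> x y /eqP xy; apply/eqP; exact: quo_lift_homo.
Qed.

Fact quo_lift_point : quo_lift_fun point = point.
Proof. by rewrite -(ptmap_point f) -quo_lift_funE. Qed.

Definition quo_lift : ptmap quo Z := PtMap quo_lift_continuous quo_lift_point.

Lemma quo_liftE x : quo_lift (quo_pi x) = f x.
Proof. exact: quo_lift_funE. Qed.
End lift.
End quotient.

Arguments quo_pi {T} r x.
Arguments quo_surj {T r} q.

(** [quo (pinch A)] is [T / A]. *)
Definition pinch (T : Type) (A : set T) : T -> T -> Prop :=
  fun x y => A x /\ A y.

(** The disjoint union of [A] and [B], pointed by the base point of [A]. *)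
Definition coprod (A B : ptopologicalType) : Type :=
  {b : bool & (if b then A else B : topologicalType)}.

Section glue.
Variables (A B : ptopologicalType).

HB.instance Definition _ := Topological.copy (coprod A B)
  {b : bool & (if b then A else B : topologicalType)}.

Definition in_left (a : A) : coprod A B := existT _ true a.
Definition in_right (b : B) : coprod A B := existT _ false b.

HB.instance Definition _ := isPointed.Build (coprod A B) (in_left point).

Lemma in_left_continuous : continuous in_left.
Proof.
exact: (@existT_continuous _
  (fun b : bool => if b then A else B : topologicalType) true).
Qed.

Lemma in_right_continuous : continuous in_right.
Proof.
exact: (@existT_continuous _
  (fun b : bool => if b then A else B : topologicalType) false).
Qed.

Variable r : A -> B -> Prop.

Definition glue_rel (u v : coprod A B) : Prop :=
  exists a b, [/\ r a b, u = in_left a & v = in_right b].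

(** The quotient of the disjoint union of [A] and [B] identifying [a] with [b]
    whenever [r a b]. The pushout of [f : C -> A] and [g : C -> B] is the case
    where [r] relates [f c] to [g c] for [c] in [C]; the hypothesis
    [r point point] below then holds because [f] and [g] are pointed. *)
Definition glue : ptopologicalType := quo glue_rel.

Definition glue_left_fun (a : A) : glue := quo_pi glue_rel (in_left a).
Definition glue_right_fun (b : B) : glue := quo_pi glue_rel (in_right b).

Fact glue_left_continuous : continuous glue_left_fun.
Proof.
apply: (comp_continuous _ in_left_continuous); exact: quo_pi_continuous.
Qed.

Fact glue_right_continuous : continuous glue_right_fun.
Proof.
apply: (comp_continuous _ in_right_continuous); exact: quo_pi_continuous.
Qed.

Lemma glueP a b : r a b -> glue_left_fun a = glue_right_fun b.
Proof. by move=> rab; apply: quo_piP; exists a, b. Qed.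

Definition glue_left : ptmap A glue :=
  @PtMap A glue glue_left_fun glue_left_continuous erefl.

Section pointed.
Hypothesis r0 : r point point.

Fact glue_right_point : glue_right_fun point = point.
Proof. by rewrite -(glueP r0). Qed.

Definition glue_right : ptmap B glue :=
  PtMap glue_right_continuous glue_right_point.

Variables (Z : ptopologicalType) (f : ptmap A Z) (g : ptmap B Z).
Hypothesis fg : forall a b, r a b -> f a = g b.

Definition copair_fun (u : coprod A B) : Z :=
  match u with
  | existT true a => f a
  | existT false b => g b
  end.

Fact copair_continuous : continuous copair_fun.
Proof.
apply/continuousP => U oU; apply/sigT_openP => -[].
- by have /continuousP := @ptmap_continuous _ _ f; apply.
by have /continuousP := @ptmap_continuous _ _ g; apply.
Qed.

Fact copair_point : copair_fun point = point.
Proof. exact: (ptmap_point f). Qed.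

Fact copair_glue u v : glue_rel u v -> copair_fun u = copair_fun v.
Proof. by move=> [a [b [rab -> ->]]]; exact: fg. Qed.

Definition glue_lift : ptmap glue Z :=
  @quo_lift _ _ _ (PtMap copair_continuous copair_point) copair_glue.

Lemma glue_lift_leftE a : glue_lift (glue_left a) = f a.
Proof. exact: quo_liftE. Qed.

Lemma glue_lift_rightE b : glue_lift (glue_right b) = g b.
Proof. exact: quo_liftE. Qed.
End pointed.
End glue.

(** * Reduced suspension and loops *)

HB.instance Definition _ (A B : ptopologicalType) :=
  Pointed.on (A * B)%type.

Section susp.
Variable R : realType.
Notation I := (unit_interval R).

Definition susp_base (Y : ptopologicalType) : set (Y * I) :=
  [set p | [\/ p.1 = point, p.2 = zero | p.2 = one]].

(** [Y * I] is pointed by [(point, zero)]. *)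
HB.instance Definition _ := isPointed.Build I zero.

Definition susp (Y : ptopologicalType) : ptopologicalType :=
  quo (pinch (@susp_base Y)).

Definition susp_pi (Y : ptopologicalType) : ptmap (Y * I)%type (susp Y) :=
  qpi (pinch (@susp_base Y)).

Section susp_map.
Variables (Y Z : ptopologicalType) (f : ptmap Y Z).

Definition susp_map_fun (p : Y * I) : susp Z := susp_pi Z (f p.1, p.2).

Fact susp_map_continuous : continuous susp_map_fun.
Proof.
have cf : continuous (fun p : Y * I => (f p.1, p.2)).
  move=> p; apply: (@cvg_pair _ _ _ (nbhs p) (nbhs (f p.1)) (nbhs p.2)).
    exact: (continuous_comp (@fst_continuous Y I p) (@ptmap_continuous _ _ f _)).
  exact: cvg_snd.
exact: (comp_continuous (ptmap_continuous (susp_pi Z)) cf).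
Qed.

Fact susp_map_point : susp_map_fun point = point.
Proof. by rewrite /susp_map_fun /= ptmap_point. Qed.

Fact susp_map_pinch p q :
  pinch (@susp_base Y) p q -> susp_map_fun p = susp_map_fun q.
Proof.
have fb u : susp_base u -> susp_base (f u.1, u.2).
  by case=> e; [apply: Or31 => /=; rewrite e ptmap_point | exact: Or32 | exact: Or33].
by move=> [/fb bp /fb bq]; apply: quo_piP.
Qed.

Definition susp_map : ptmap (susp Y) (susp Z) :=
  quo_lift (f := PtMap susp_map_continuous susp_map_point) susp_map_pinch.

Lemma susp_mapE y t : susp_map (susp_pi Y (y, t)) = susp_pi Z (f y, t).
Proof. exact: quo_liftE. Qed.
End susp_map.

(** The set of based loops with the compact-open topology. *)
Definition based_loop (X : ptopologicalType) : Type :=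
  {path I from (point : X) to (point : X)}.

HB.instance Definition _ (X : ptopologicalType) := Topological.copy
  (based_loop X) {path I from (point : X) to (point : X)}.
HB.instance Definition _ (X : ptopologicalType) :=
  isPointed.Build (based_loop X) (cst (point : X)).

Definition loop (X : ptopologicalType) : ptopologicalType := kify (based_loop X).

Section loop_map.
Variables (X Y : ptopologicalType) (f : ptmap X Y).

Fact loop_map_cts_subproof (w : based_loop X) : continuous (f \o w).
Proof.
by apply: comp_continuous; [exact: ptmap_continuous | exact: cts_fun].
Qed.
Fact loop_map0_subproof (w : based_loop X) : (f \o w) zero = point.
Proof. by rewrite /= path_zero ptmap_point. Qed.
Fact loop_map1_subproof (w : based_loop X) : (f \o w) one = point.
Proof. by rewrite /= path_one ptmap_point. Qed.

Definition loop_map_fun (w : loop X) : loop Y :=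
  mk_path (@loop_map_cts_subproof w) (loop_map0_subproof w)
    (loop_map1_subproof w).

Fact loop_map_continuous : continuous loop_map_fun.
Proof.
apply: kify_map_continuous; apply: continuous_comp_initial.
have c : continuous (idfun : based_loop X -> {compact-open, I -> X}).
  exact: initial_continuous.
exact: (comp_continuous (postcomp_continuous (ptmap_continuous f)) c).
Qed.

Fact loop_map_point : loop_map_fun point = point.
Proof. by apply/path_eqP => t; exact: ptmap_point. Qed.

Definition loop_map : ptmap (loop X) (loop Y) :=
  PtMap loop_map_continuous loop_map_point.

Lemma loop_mapE (w : loop X) t :
  (loop_map w : based_loop Y) t = f ((w : based_loop X) t).
Proof. by []. Qed.
End loop_map.

Section ev.
Variable X : ptopologicalType.

Definition ev_fun (p : loop X * I) : X := (p.1 : based_loop X) p.2.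

Fact ev_continuous : continuous ev_fun.
Proof.
apply: (@path_eval_continuous R (loop X) X
  (fun w => (w : based_loop X) : {compact-open, I -> X})).
  have c : continuous (idfun : based_loop X -> {compact-open, I -> X}).
    exact: initial_continuous.
  exact: (comp_continuous c (@kify_id_continuous (based_loop X))).
by move=> w; exact: cts_fun.
Qed.

Fact ev_point : ev_fun point = point.
Proof. by []. Qed.

Fact ev_pinch p q : pinch (@susp_base (loop X)) p q -> ev_fun p = ev_fun q.
Proof.
have ev0 u : susp_base u -> ev_fun u = point.
  by case: u => w t [] /= ->; rewrite /ev_fun ?path_zero ?path_one.
by move=> [/ev0-> /ev0->].
Qed.

Definition ev : ptmap (susp (loop X)) X :=
  quo_lift (f := PtMap ev_continuous ev_point) ev_pinch.

Lemma evE w t : ev (susp_pi (loop X) (w, t)) = (w : based_loop X) t.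
Proof. exact: quo_liftE. Qed.
End ev.

Definition susp_loop (X : ptopologicalType) : ptopologicalType :=
  susp (loop X).

Definition susp_loop_map (X Y : ptopologicalType) (f : ptmap X Y) :
  ptmap (susp_loop X) (susp_loop Y) := susp_map (loop_map f).

Lemma susp_loop_surj (X : ptopologicalType) (q : susp_loop X) :
  exists w t, q = susp_pi (loop X) (w, t).
Proof. by have [[w t] ->] := quo_surj q; exists w, t. Qed.

Lemma ev_natural (X Y : ptopologicalType) (f : ptmap X Y) q :
  ev Y (susp_loop_map f q) = f (ev X q).
Proof.
have [w [t ->]] := susp_loop_surj q.
by rewrite /susp_loop_map (susp_mapE (loop_map f)) !evE.
Qed.

Lemma susp_loop_map_comp (X Y Z : ptopologicalType)
    (f : ptmap X Y) (g : ptmap Y Z) (h : ptmap X Z) :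
  (forall x, g (f x) = h x) ->
  forall q, susp_loop_map g (susp_loop_map f q) = susp_loop_map h q.
Proof.
move=> gfh q; have [w [t ->]] := susp_loop_surj q.
rewrite /susp_loop_map [X in susp_map _ X](susp_mapE (loop_map f)).
rewrite (susp_mapE (loop_map g)) (susp_mapE (loop_map h)).
congr (susp_pi _ (_, _)).
by apply/path_eqP => s; exact: gfh.
Qed.

End susp.

(** * Fibration associated to a map, fibre, mapping cone *)

Section fibration.
Variables (R : realType) (A X : ptopologicalType) (f : ptmap A X).
Notation I := (unit_interval R).

(** All paths in [X], with the compact-open topology. *)
Definition free_path : topologicalType :=
  @initial_topology (continuousType I X) {compact-open, I -> X}
    (fun w => w : I -> X).

Definition path_pullback_set : set (A * free_path) :=
  [set p | (p.2 : continuousType I X) zero = f p.1].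

Definition path_pullback : Type := path_pullback_set.

HB.instance Definition _ :=
  Topological.copy path_pullback (set_type path_pullback_set).

Fact path_pullback_point_subproof :
  (point, (cst (point : X) : continuousType I X) : free_path)
    \in path_pullback_set.
Proof. by rewrite inE /path_pullback_set /= ptmap_point. Qed.

HB.instance Definition _ := isPointed.Build path_pullback
  (exist (fun p => p \in path_pullback_set) _ path_pullback_point_subproof).

(** The total space [{(a, w) | w 0 = f a}] of the fibration [(a, w) |-> w 1]
    associated to [f]. *)
Definition path_space : ptopologicalType := kify path_pullback.

Definition path_fibration_fun (p : path_space) : X :=
  ((\val (p : path_pullback)).2 : continuousType I X) one.

Fact path_fibration_continuous : continuous path_fibration_fun.
Proof.
apply: (@path_eval1_continuous R path_space X one
  (fun p => ((\val (p : path_pullback)).2 : continuousType I X)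
     : {compact-open, I -> X})).
  have c1 : continuous (\val : path_pullback -> A * free_path).
    exact: initial_continuous.
  have c2 : continuous
      (fun w : free_path => (w : continuousType I X) : {compact-open, I -> X}).
    exact: initial_continuous.
  have c3 := comp_continuous c2 (comp_continuous (@snd_continuous _ _) c1).
  exact: (comp_continuous c3 (@kify_id_continuous path_pullback)).
by move=> p; exact: cts_fun.
Qed.

Fact path_fibration_point : path_fibration_fun point = point.
Proof. by []. Qed.

Definition path_fibration : ptmap path_space X :=
  PtMap path_fibration_continuous path_fibration_point.

End fibration.

Section fibre.
Variables (G X : ptopologicalType) (p : ptmap G X).

Definition fibre_set : set G := [set g | p g = point].

Definition fibre_carrier : Type := fibre_set.

HB.instance Definition _ :=
  Topological.copy fibre_carrier (set_type fibre_set).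

Fact fibre_point_subproof : (point : G) \in fibre_set.
Proof. by rewrite inE /fibre_set /= ptmap_point. Qed.

HB.instance Definition _ := isPointed.Build fibre_carrier
  (exist (fun g => g \in fibre_set) _ fibre_point_subproof).

Definition fibre : ptopologicalType := kify fibre_carrier.

Definition fibre_incl_fun (g : fibre) : G := \val (g : fibre_carrier).

Fact fibre_incl_continuous : continuous fibre_incl_fun.
Proof.
have c : continuous (\val : fibre_carrier -> G) by exact: initial_continuous.
exact: (comp_continuous c (@kify_id_continuous fibre_carrier)).
Qed.

Definition fibre_incl : ptmap fibre G :=
  @PtMap fibre G fibre_incl_fun fibre_incl_continuous erefl.

Lemma fibre_inclP g : p (fibre_incl g) = point.
Proof. exact: (set_mem (valP (g : fibre_carrier))). Qed.

End fibre.

Section mapping_cone.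
Variables (R : realType) (F G : ptopologicalType) (j : ptmap F G).
Notation I := (unit_interval R).

(** The reduced cone; [F] sits at [zero] and the apex is at [one]. *)
Definition cone_base : set (F * I) := [set u | u.1 = point \/ u.2 = one].

Definition cone : ptopologicalType := quo (pinch cone_base).

Definition cone_pi : ptmap (F * I)%type cone := qpi (pinch cone_base).

Definition attach (g : G) (c : cone) : Prop :=
  exists a : F, g = j a /\ c = cone_pi (a, zero).

Definition mapping_cone : ptopologicalType := glue attach.

Fact attach_point : attach point point.
Proof. by exists point; rewrite ptmap_point. Qed.

End mapping_cone.

(** * The Ganea fibrations *)

Section ganea.
Variable R : realType.

(** [p'_(n+1)] from [p_n = p]. The map which is [p] on [G] and constant on the
    cone is well defined because the homotopy fibre of the fibration [p] is
    taken to be the actual fibre over the base point. *)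
Section step.
Variables (G X : ptopologicalType) (p : ptmap G X).

Definition const_map (A B : ptopologicalType) : ptmap A B :=
  @PtMap A B (cst point) (fun x => cvg_cst _) erefl.

Fact ganea_cone_subproof (g : G) (c : cone R (fibre p)) :
  attach (fibre_incl p) g c -> p g = const_map (cone R (fibre p)) X c.
Proof. by move=> [a [-> _]]; rewrite fibre_inclP. Qed.

Definition ganea_cone : ptmap (mapping_cone R (fibre_incl p)) X :=
  glue_lift ganea_cone_subproof.

End step.

Fixpoint ganea_seq (X : ptopologicalType) (n : nat) :
    {G : ptopologicalType & ptmap G X} :=
  match n with
  | 0 => existT _ _ (path_fibration R (ev R X))
  | n'.+1 => existT _ _ (path_fibration R (ganea_cone (projT2 (ganea_seq X n'))))
  end.

(** [G_n] is indexed from 1; [ganea X 0] is a dummy value equal to [G_1]. *)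
Definition ganea (X : ptopologicalType) (n : nat) : ptopologicalType :=
  projT1 (ganea_seq X n.-1).
Definition ganea_map (X : ptopologicalType) (n : nat) : ptmap (ganea X n) X :=
  projT2 (ganea_seq X n.-1).

End ganea.

(** * Facial spaces and their realizations *)

(** [fs_face S n i] is [d_i : S_(n+1) -> S_n]; only the indices [i <= n+1] are
    meaningful. *)
Record facial_space := FacialSpace {
  fs_obj :> nat -> ptopologicalType;
  fs_face : forall n, nat -> ptmap (fs_obj n.+1) (fs_obj n);
  fs_faceP : forall n i j, (i < j <= n.+2)%N -> forall x,
    fs_face n i (fs_face n.+1 j x) = fs_face n j.-1 (fs_face n.+1 i x)
}.

Record facial_resolution (X : ptopologicalType) := FacialResolution {
  fr_space :> facial_space;
  fr_aug : ptmap (fr_space 0) X;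
  fr_augP : forall x,
    fr_aug (fs_face fr_space 0 0 x) = fr_aug (fs_face fr_space 0 1 x)
}.

Section simplex.
Variable R : realType.

Definition simplex_set (n : nat) : set 'rV[R]_n.+1 :=
  [set x | (forall i, 0 <= x ord0 i) /\ \sum_i x ord0 i = 1].
Arguments simplex_set : clear implicits.

Definition simplex (n : nat) : Type := simplex_set n.

HB.instance Definition _ (n : nat) :=
  Topological.copy (simplex n) (set_type (simplex_set n)).

Fact vertex_subproof n : (delta_mx ord0 ord0 : 'rV[R]_n.+1) \in simplex_set n.
Proof.
rewrite inE; split=> [i|]; first by rewrite mxE ler0n.
rewrite (bigD1 ord0)//= mxE !eqxx big1 ?addr0// => i /negbTE i0.
by rewrite mxE i0 andbF.
Qed.

HB.instance Definition _ (n : nat) :=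
  isPointed.Build (simplex n) (exist (fun x => x \in simplex_set n) _ (vertex_subproof n)).

Definition coface_row n (i : 'I_n.+2) (t : 'rV[R]_n.+1) : 'rV[R]_n.+2 :=
  \row_j if unlift i j is Some k then t ord0 k else 0.

Fact coface_subproof n (i : 'I_n.+2) (t : simplex n) :
  coface_row i (\val t) \in simplex_set n.+1.
Proof.
have [t0 t1] := set_mem (valP t); rewrite inE; split=> [j|].
  by rewrite mxE; case: unliftP.
rewrite (bigD1_ord i)//= mxE unlift_none add0r -[RHS]t1.
by apply: eq_bigr => k _; rewrite mxE liftK.
Qed.

Definition coface n (i : 'I_n.+2) (t : simplex n) : simplex n.+1 :=
  exist (fun x => x \in simplex_set n.+1) _ (coface_subproof i t).

End simplex.

Section half_smash.
Variables (X Y : ptopologicalType).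

(** The half-smash product [X x Y / (point x Y)]; the base point of [Y] plays
    no role. *)
Definition half_smash_base : set (X * Y) := [set p | p.1 = point].

Definition half_smash : ptopologicalType := quo (pinch half_smash_base).

Definition half_smash_pi : ptmap (X * Y)%type half_smash :=
  qpi (pinch half_smash_base).

Lemma half_smash_point (y : Y) : half_smash_pi (point, y) = point.
Proof. exact: quo_piP. Qed.

Fact half_smash_fst_pinch p q : pinch half_smash_base p q -> p.1 = q.1.
Proof. by move=> [-> ->]. Qed.

Definition half_smash_fst : ptmap half_smash X :=
  quo_lift (f := @PtMap (X * Y)%type X fst (@fst_continuous X Y) erefl)
    half_smash_fst_pinch.

Lemma half_smash_fstE x y : half_smash_fst (half_smash_pi (x, y)) = x.
Proof. exact: quo_liftE. Qed.

End half_smash.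
Arguments half_smash_fst : clear implicits.

Section realization.
Variables (R : realType) (S : facial_space).

(** The graph of the attaching map
    [phi_(n+1) : S_(n+1) |x bd Delta^(n+1) -> || S ||_n]:
    [(x, delta^i t) |-> chi_n (d_i x, t)]. Gluing along it is the pushout of
    [phi_(n+1)] and the inclusion of [S_(n+1) |x bd Delta^(n+1)]. *)
Definition face_glue n (Y : ptopologicalType)
    (chi : ptmap (half_smash (S n) (simplex R n)) Y) (y : Y)
    (z : half_smash (S n.+1) (simplex R n.+1)) : Prop :=
  exists (i : 'I_n.+2) (x : S n.+1) (t : simplex R n),
    y = chi (half_smash_pi _ _ (fs_face S n i x, t)) /\
    z = half_smash_pi _ _ (x, coface i t).

Fact face_glue_point n Y chi : @face_glue n Y chi point point.
Proof.
exists ord0, point, point; split; last by rewrite half_smash_point.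
by rewrite ptmap_point half_smash_point ptmap_point.
Qed.

(** [|| S ||_n] together with [chi_n]. *)
Fixpoint realization_seq (n : nat) :
    {Y : ptopologicalType & ptmap (half_smash (S n) (simplex R n)) Y} :=
  match n with
  | 0 => existT _ (S 0) (half_smash_fst (S 0) (simplex R 0))
  | n'.+1 =>
      existT _ _ (glue_right (face_glue_point (projT2 (realization_seq n'))))
  end.

Definition realization (n : nat) : ptopologicalType :=
  projT1 (realization_seq n).
Definition realization_chi (n : nat) :
  ptmap (half_smash (S n) (simplex R n)) (realization n) :=
  projT2 (realization_seq n).
Definition realization_incl (n : nat) :
  ptmap (realization n) (realization n.+1) :=
  glue_left (face_glue (realization_chi n)).

End realization.

Section canonical_map.
Variables (R : realType) (X : ptopologicalType) (S : facial_resolution X).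

(** [(d_0)^(n+1) : S_n -> X] *)
Fixpoint iter_aug (n : nat) : ptmap (S n) X :=
  match n with
  | 0 => fr_aug S
  | n'.+1 => ptcomp (iter_aug n') (fs_face S n' 0)
  end.

Lemma iter_aug_face n i x : (i <= n.+1)%N ->
  iter_aug n (fs_face S n i x) = iter_aug n.+1 x.
Proof.
elim: n i x => [|n IHn] [|i] x //= le_i_n.
  by move: le_i_n; case: i => // _; rewrite fr_augP.
by rewrite (@fs_faceP S n 0 i.+1) ?IHn.
Qed.

Definition canonical_spec n (c : ptmap (realization R S n) X) : Prop :=
  forall x t,
    c (realization_chi R S n (half_smash_pi _ _ (x, t))) = iter_aug n x.

Fact canonical_spec0 : @canonical_spec 0 (fr_aug S).
Proof. by move=> x t; exact: (congr1 (fr_aug S) (half_smash_fstE x t)). Qed.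

Section step.
Variables (n : nat) (c : ptmap (realization R S n) X).
Hypothesis cE : canonical_spec c.

Let pr_aug : ptmap (half_smash (S n.+1) (simplex R n.+1)) X :=
  ptcomp (iter_aug n.+1) (half_smash_fst _ _).

Fact canonical_glue y z :
  face_glue (realization_chi R S n) y z -> c y = pr_aug z.
Proof.
move=> [i [x [t [-> ->]]]].
rewrite cE iter_aug_face; last by rewrite -ltnS ltn_ord.
exact: (esym (congr1 (iter_aug n.+1) (half_smash_fstE x (coface i t)))).
Qed.

Definition canonical_step : ptmap (realization R S n.+1) X :=
  glue_lift canonical_glue.

Fact canonical_stepE : canonical_spec canonical_step.
Proof.
move=> x t.
have := glue_lift_rightE (face_glue_point (realization_chi R S n))
  canonical_glue (half_smash_pi _ _ (x, t)).
by move=> ->; exact: (congr1 (iter_aug n.+1) (half_smash_fstE x t)).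
Qed.
End step.

Fixpoint canonical_seq (n : nat) :
    {c : ptmap (realization R S n) X | canonical_spec c} :=
  match n with
  | 0 => exist _ _ canonical_spec0
  | n'.+1 => exist _ _ (canonical_stepE (svalP (canonical_seq n')))
  end.

Definition canonical_map (n : nat) : ptmap (realization R S n) X :=
  sval (canonical_seq n).

Lemma canonical_map0 x : canonical_map 0 x = fr_aug S x.
Proof. by []. Qed.

Lemma canonical_map_incl n y :
  canonical_map n.+1 (realization_incl R S n y) = canonical_map n y.
Proof.
exact: (glue_lift_leftE (canonical_glue (svalP (canonical_seq n)))).
Qed.

Lemma canonical_map_chi n z :
  canonical_map n (realization_chi R S n z) =
  iter_aug n (half_smash_fst (S n) (simplex R n) z).
Proof.
have [[x t] ->] := quo_surj z.
by rewrite (svalP (canonical_seq n)) half_smash_fstE.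
Qed.

End canonical_map.

(** * The resolution [Lambda X] *)

Section Lambda.
Variables (R : realType) (X : ptopologicalType).

(** [SOn n] is the [n]-th iterate of [Sigma Omega] on [X] and [SO_face n i] is
    [(Sigma Omega)^i ev : SOn n.+1 -> SOn n], the [ev] being that of
    [SOn (n - i)]. *)
Definition SOn (n : nat) : ptopologicalType := iter n (susp_loop R) X.

Fixpoint SO_face (n i : nat) {struct n} : ptmap (SOn n.+1) (SOn n) :=
  match n return ptmap (SOn n.+1) (SOn n) with
  | 0 => ev R X
  | n'.+1 => match i with
             | 0 => ev R (SOn n'.+1)
             | i'.+1 => susp_loop_map R (SO_face n' i')
             end
  end.

Lemma SO_faceP n i j : (i < j <= n.+1)%N -> forall x,
  SO_face n i (SO_face n.+1 j x) = SO_face n j.-1 (SO_face n.+1 i x).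
Proof.
have SO0 m k y : SO_face m 0 (susp_loop_map R (SO_face m k) y) =
    SO_face m k (SO_face m.+1 0 y).
  by case: m k y => [|m] k y; exact: ev_natural.
elim: n i j => [|n IHn] [|i] [|j] /andP[ij jn] x //; try exact: SO0.
case: j ij jn => // j; rewrite !ltnS => ij jn.
pose h := ptcomp (SO_face n i) (SO_face n.+1 j.+1).
rewrite [LHS](@susp_loop_map_comp R _ _ _ (SO_face n.+1 j.+1) (SO_face n i) h)//.
rewrite [RHS](@susp_loop_map_comp R _ _ _ (SO_face n.+1 i) (SO_face n j) h)//.
by move=> y; apply/esym/(IHn i j.+1); apply/andP; split.
Qed.

Definition Lambda_facial : facial_space :=
  @FacialSpace (fun n => SOn n.+1) (fun n => SO_face n.+1)
    (fun n => @SO_faceP n.+1).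

Definition Lambda : facial_resolution X :=
  @FacialResolution X Lambda_facial (SO_face 0 0)
    (fun x => esym (@SO_faceP 0 0 1 isT x)).

End Lambda.

(* Main.v *)
From HB Require Import structures.
From mathcomp Require Import all_boot all_order all_algebra generic_quotient.
From mathcomp Require Import all_classical reals topology homotopy normedtype.
From mathcomp Require Import ring lra.
Require Import Defs.

(** The realization through dimension 1, called [L] here, is the reduced
    homotopy coequalizer of [ev] and [Sigma Omega ev] from
    [Sigma Omega Sigma Omega X] to [Sigma Omega X]: for every loop [w] in
    [Sigma Omega X] and every time [t] it contains an edge from the point [w t]
    to the point [[ev w, t]] of the suspension ([cell_h0], [cell_h1]).  The
    space [G_2] consists of a point of the mapping cone [C] of [F_1 -> G_1]
    together with a path in [X] starting at its image.

    From [L] to [G_2].  The loops [w] and [t |-> [ev w, t]] have the same image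
    [a] in [X].  In [C] a point of either loop can be contracted: drag it along
    the reverse of [a] into the fibre, then up the cone.  At the end of the loop
    the contraction depends on [a] only, so the two contractions can be joined
    there, and a reparametrization makes the resulting bridge from [w t] to
    [[ev w, t]] trivial at [t = 0] and [t = 1].  Its image in [X] runs through
    [a] in another parametrization; the path coordinate of [G_2] absorbs the
    difference, and the map [L -> G_2] is over [X] on the nose
    ([realization_to_ganea]).

    From [G_2] to [L].  It suffices to map [C] to [L].  On [G_1] the map forgets
    the path.  For a loop [a] in [X], a time [s] and a path [y] from [a s] to
    the base point one needs a path in [L] from [[a, s]] to the base point, lying
    over [y] up to homotopy, which depends on [y] only when [s = 0], [s = 1] or
    [a] is constant, since then [[a, s]] is the base point.  The path [omega]
    walks from [[a, s]] back to time 0 and then through the suspended loop of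
    [a] up to [s] followed by [y]; this is right for [s = 0].  For [s = 1] it is
    a loop [w], and the edges of [L] move it to the suspended loop of its image
    [a^-1 a y]; that image deforms in [X] to [y], and edges of the same kind
    lead back to the loop obtained for constant [a] ([fill1], [fill2]).  For
    constant [a] this correction runs through the edges of a single loop and
    back.  Such edges are not trivial in [L], as a facial space has no
    degeneracies, so the correction has to be cut off near the constant loop:
    well-pointedness gives a map [k : X -> X], homotopic to the identity, and a
    function [psi] on loops, equal to 1 at the constant loop, such that [k] kills
    every loop with [psi > 0] ([well_pointed_loop]).  All loops are moved by [k],
    and [psi] says how much of the correction is cut off ([fill], [fill_base]).

    These formulas live on [Omega X * I] over [X], of which the fibre [F_1] only
    sees the quotient [Sigma Omega X].  That a pulled back quotient map is still
    a quotient map for compactly generated spaces uses that [X] is weak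
    Hausdorff, and is checked on maps from compact Hausdorff spaces
    ([quo_descent_continuous]).  Finally the image of the path in [X] is deformed
    to [y], and then along [y] to its end ([sweep]); this gives the homotopy over
    [X] ([from_cone_homotopic]). *)

Set Implicit Arguments.
Unset Strict Implicit.
Unset Printing Implicit Defensive.

Import Order.TTheory GRing.Theory Num.Theory.
Import numFieldTopology.Exports.
Import numFieldNormedType.Exports.

Local Open Scope classical_set_scope.
Local Open Scope ring_scope.
Local Open Scope quotient_scope.

(** * Compactly generated spaces and quotients *)

Lemma pair_continuous (V A B : topologicalType) (f : V -> A) (g : V -> B) :
  continuous f -> continuous g -> continuous (fun v => (f v, g v)).
Proof.
by move=> cf cg v; apply: (@cvg_pair _ _ _ (nbhs v) (nbhs (f v)) (nbhs (g v)));
  [exact: cf|exact: cg].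
Qed.

Definition compact_hausdorff (K : topologicalType) :=
  compact [set: K] /\ hausdorff_space K.

Lemma hausdorff_inj (A B : topologicalType) (f : A -> B) :
  continuous f -> injective f -> hausdorff_space B -> hausdorff_space A.
Proof.
move=> cf injf hB p q clpq; apply: injf; apply: hB => U V Up Vq.
by have [x [Ux Vx]] := clpq _ _ (cf p _ Up) (cf q _ Vq); exists (f x).
Qed.

Lemma compact_hausdorff_prod (K L : topologicalType) :
  compact_hausdorff K -> compact_hausdorff L -> compact_hausdorff (K * L)%type.
Proof.
move=> [cK hK] [cL hL]; split; first by rewrite -setXTT; exact: compact_setX.
move=> [p1 p2] [q1 q2] clpq; congr pair.
- apply: hK => U V Up Vq.
  have [[x y] [Ux Vx]] := clpq _ _ (@fst_continuous K L (p1, p2) _ Up)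
    (@fst_continuous K L (q1, q2) _ Vq).
  by exists x.
- apply: hL => U V Up Vq.
  have [[x y] [Ux Vx]] := clpq _ _ (@snd_continuous K L (p1, p2) _ Up)
    (@snd_continuous K L (q1, q2) _ Vq).
  by exists y.
Qed.

Lemma compact_hausdorff_closed (K : topologicalType) (C : set K) :
  compact_hausdorff K -> closed C -> compact_hausdorff (set_type C).
Proof.
move=> [cK hK] cC; split; last first.
  exact: (hausdorff_inj (@initial_continuous C K set_val) val_inj).
have {}cK : compact C by apply: (subclosed_compact cC cK).
move=> F FF _; pose v : C -> K := \val.
have FvC : (v @ F) C.
  change (F (v @^-1` C)).
  by apply: filterS (filterT : F setT) => t _; exact: (set_mem (valP t)).
have [p [pC clp]] := cK (v @ F) _ FvC.
have pC' : p \in C by rewrite inE.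
exists (exist _ p pC' : C); split=> // A B FA [_ [[D oD <-] /= Dp DB]].
have [_ [[t At <-] Dt]] : (v @` A) `&` D !=set0.
  apply: clp; last exact: open_nbhs_nbhs.
  change (F (v @^-1` (v @` A))).
  by apply: filterS FA => t At; exists t.
by exists t; split=> //; exact: DB.
Qed.

Lemma compact_hausdorff_regular (K : topologicalType) :
  compact_hausdorff K -> @regular_space K.
Proof. by move=> [cK hK] x; apply: (compact_regular hK cK); exact: filterT. Qed.

Lemma k_space_compact_hausdorff (K : topologicalType) : compact_hausdorff K ->
    k_space K.
Proof. by move=> [cK hK] U /(_ K idfun cK hK); apply=> x; exact: cvg_id. Qed.

Lemma k_space_continuous (S Z : topologicalType) (f : S -> Z) : k_space S ->
  (forall (K : topologicalType) (u : K -> S), compact_hausdorff K ->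
     continuous u -> continuous (f \o u)) ->
  continuous f.
Proof.
move=> kS cf; apply/continuousP => U oU; apply: kS => K u cK hK cu.
by rewrite -comp_preimage; apply: open_comp => // x _; exact: cf.
Qed.

Lemma kify_lift_continuous (S T : topologicalType) (f : S -> T) :
  k_space S -> continuous f -> continuous (f : S -> kify T).
Proof.
move=> kS cf; apply/continuousP => U; rewrite kify_openE => kU.
apply: kS => K u cK hK cu; rewrite -comp_preimage.
by apply: kU => //; exact: comp_continuous.
Qed.

Lemma k_space_kify (T : topologicalType) : k_space (kify T).
Proof.
move=> U kU; rewrite kify_openE => K u cK hK cu; apply: (kU K u cK hK).
by apply: kify_lift_continuous => //;
  exact: k_space_compact_hausdorff (conj cK hK).
Qed.

Lemma k_space_quo (T : ptopologicalType) (r : T -> T -> Prop) :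
  k_space T -> k_space (quo r).
Proof.
move=> kT U kU.
suff: open (quo_pi r @^-1` U) by [].
apply: kT => K u cK hK cu; rewrite -comp_preimage; apply: kU => //.
by apply: comp_continuous => //; exact: quo_pi_continuous.
Qed.

Lemma tube_open (S K : topologicalType) (W : set (S * K)) (C : set K) :
  compact C -> open W -> open [set s | forall k, C k -> W (s, k)].
Proof.
move=> cC oW; rewrite openE => s Ws.
change (\forall s' \near s, C `<=` [set k | W (s', k)]).
apply: (iffLR (compact_near_coveringP C) cC) => k Ck.
have [[P Q] [Ps Qk] PQ] := open_nbhs_nbhs (conj oW (Ws k Ck)).
by exists (Q, P) => // -[b a] /= [Qb Pa]; exact: (PQ (a, b)).
Qed.

(** Neighbourhoods in a product with a compact Hausdorff factor can be taken to
    be boxes with compact second side, so openness reduces to slices and tubes.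
    This one criterion shows that a product with a compact Hausdorff space
    preserves both k-spaces and quotient maps. *)
Lemma tubes_open (S K : topologicalType) (W : set (S * K)) :
  compact_hausdorff K ->
  (forall s, open [set k | W (s, k)]) ->
  (forall C : set K, compact C -> open [set s | forall k, C k -> W (s, k)]) ->
  open W.
Proof.
move=> cH oK oS; rewrite openE => -[s k] Wsk.
have [V Vk VW] := compact_hausdorff_regular cH (open_nbhs_nbhs (conj (oK s)
  Wsk)).
have cC : compact (closure V) by apply: (subclosed_compact (@closed_closure _ V)
  cH.1).
exists ([set s' | forall k', closure V k' -> W (s', k')], V).
  split=> //; apply: open_nbhs_nbhs; split; first exact: oS.
  exact: VW.
by move=> [s' k'] /= [Ws' Vk']; apply: Ws'; exact: subset_closure.
Qed.

Lemma k_space_prod (S K : topologicalType) :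
  k_space S -> compact_hausdorff K -> k_space (S * K)%type.
Proof.
move=> kS cH U kU; apply: tubes_open => // [s|C cC].
  apply: (kU K (fun k => (s, k))); [exact: cH.1|exact: cH.2|].
  by apply: pair_continuous => x; [exact: cvg_cst|exact: cvg_id].
apply: kS => L u cL hL cu.
have [cLK hLK] := compact_hausdorff_prod (conj cL hL) cH.
apply: (tube_open (W := [set p : L * K | U (u p.1, p.2)])) cC _.
apply: (kU (L * K)%type (fun p => (u p.1, p.2))) => //.
apply: pair_continuous; last exact: snd_continuous.
by apply: comp_continuous => //; exact: fst_continuous.
Qed.

Lemma slice_open (S K : topologicalType) (W : set (S * K)) s :
  open W -> open [set k | W (s, k)].
Proof.
move=> oW; apply: (open_comp (f := fun k => (s, k))) => // x _.
by apply: pair_continuous => ?; [exact: cvg_cst|exact: cvg_id].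
Qed.

Lemma quo_prod_open (T : ptopologicalType) (r : T -> T -> Prop)
    (K : topologicalType) (W : set (quo r * K)) : compact_hausdorff K ->
  open [set p : T * K | W (quo_pi r p.1, p.2)] -> open W.
Proof.
move=> cH oW; apply: tubes_open => // [q|C cC].
  by have [x ->] := quo_surj q; exact: (slice_open x oW).
exact: (tube_open cC oW).
Qed.

Lemma quo_prod_continuous (T : ptopologicalType) (r : T -> T -> Prop)
    (K Z : topologicalType) (H : quo r * K -> Z) : compact_hausdorff K ->
  continuous (fun p : T * K => H (quo_pi r p.1, p.2)) -> continuous H.
Proof.
move=> cH cT; apply/continuousP => U oU; apply: quo_prod_open => //.
exact: (iffLR (continuousP _) cT U oU).
Qed.

Lemma weak_hausdorff_closed1 (X : topologicalType) (x : X) :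
  weak_hausdorff X -> closed [set x].
Proof.
move=> wX; pose K : topologicalType := set_type [set x].
pose k : K := exist _ x (mem_set erefl).
have Kk (y : K) : y = k by apply/val_inj; exact: (set_mem (valP y)).
rewrite (_ : [set x] = range (set_val : K -> X)); last first.
  by apply/seteqP; split=> [_ ->|_ [y _ <-]]; [exists k|rewrite (Kk y)].
apply: wX; last exact: initial_continuous; last by move=> y z;
  rewrite (Kk y) (Kk z).
move=> F FF _; exists k; split=> // A B FA Bk.
have [y Ay] := filter_ex FA; exists k; split; first by rewrite -(Kk y).
exact: nbhs_singleton.
Qed.

Lemma weak_hausdorff_image (X K : topologicalType) (u : K -> X) (C : set K) :
  weak_hausdorff X -> compact_hausdorff K -> continuous u -> closed C ->
  closed (u @` C).
Proof.
move=> wX cH cu cC; have [cC' hC'] := compact_hausdorff_closed cH cC.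
rewrite (_ : u @` C = range (u \o (set_val : set_type C -> K))).
  apply: wX => //; apply: comp_continuous => //; exact: initial_continuous.
apply/seteqP; split=> [_ [k Ck <-]|_ [[k Ck] _ <-]].
  by exists (exist _ k (mem_set Ck)).
by exists k => //; exact: (set_mem Ck).
Qed.

(** The diagonal of a weak Hausdorff space is closed as far as compact Hausdorff
    spaces can see: if [f a] and [g a] differ, a closed neighbourhood of [a]
    whose image under [f] misses [g a] has closed image, and [g] avoids that
    image near [a]. *)
Lemma weak_hausdorff_closed_eq (X K : topologicalType) (f g : K -> X) :
  weak_hausdorff X -> compact_hausdorff K -> continuous f -> continuous g ->
  closed [set k | f k = g k].
Proof.
move=> wX cH cf cg; rewrite -openC openE => a /= fga.
have oU : open (f @^-1` (~` [set g a])).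
  apply: open_comp; first by move=> x _; exact: cf.
  by rewrite openC; exact: weak_hausdorff_closed1.
have [V Va VU] := compact_hausdorff_regular cH (open_nbhs_nbhs (conj oU fga)).
have oW : open (g @^-1` (~` (f @` closure V))).
  apply: open_comp; first by move=> x _; exact: cg.
  by rewrite openC; apply: weak_hausdorff_image => //; exact: closed_closure.
have ga : (g @^-1` (~` (f @` closure V))) a.
  by move=> [y Vy fy]; exact: (VU _ Vy).
apply: filterS (filterI Va (open_nbhs_nbhs (conj oW ga))) => y [Vy gy] /= fgy.
by apply: gy; exists y => //; exact: subset_closure.
Qed.

Lemma paste_continuous (R : realType) (V Z : topologicalType) (c : V -> R)
    (b : R) (f g : V -> Z) : continuous c -> continuous f -> continuous g ->
  (forall v, c v = b -> f v = g v) ->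
  continuous (fun v => if c v <= b then f v else g v).
Proof.
move=> cc cf cg fg; apply/continuous_subspace_setT.
have -> : [set: V] = (c @^-1` [set x | x <= b]) `|` (c @^-1` [set x | b <= x]).
  by apply/seteqP; split=> // v _; have [/ltW|] := ltP (c v) b; [left|right].
apply: (withinU_continuous (A := c @^-1` [set x | x <= b])
  (B := c @^-1` [set x | b <= x])).
- by apply: closed_comp => [v _|]; [exact: cc|exact: closed_le].
- by apply: closed_comp => [v _|]; [exact: cc|exact: closed_ge].
- apply: (@subspace_eq_continuous _ _ _ f).
    by move=> v; rewrite inE /from_subspace /= => ->.
  by apply: continuous_subspaceT.
- apply: (@subspace_eq_continuous _ _ _ g).
    move=> v; rewrite inE /from_subspace /= => bv; case: ifPn => // vb.
    by apply/esym/fg/eqP; rewrite eq_le vb bv.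
  by apply: continuous_subspaceT.
Qed.

Lemma quo_pinchP (T : ptopologicalType) (A : set T) x y :
  quo_pi (pinch A) x = quo_pi (pinch A) y -> x = y \/ A x /\ A y.
Proof.
move=> /eqmodP/asboolP; elim=> {x y} [x y []|x|x y _ [->|[]]|x y z _ xy _ yz].
- by right.
- by left.
- by left.
- by right.
- by case: xy yz => [->|[Ax Ay]] [<-|[Ay' Az]]; [left|right|right|right].
Qed.

(** The pullback of a quotient map along a map of compactly generated spaces
    over a weak Hausdorff [X] is a quotient map. Concretely, [F] is only
    meaningful on the pairs [(t, s)] lying over the same point of [X], and need
    only be continuous there, when tested on compact Hausdorff spaces. For a
    test [K -> S], the preimage of a closed set is closed in [T * K] because the
    equation over [X] is a closed condition; it is saturated, so its image in
    [quo r * K] is closed, and it remains to pull back along the graph of [K ->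
    quo r]. *)
Lemma quo_descent_continuous (X S Z : topologicalType)
    (T : ptopologicalType) (r : T -> T -> Prop) (e : quo r -> X)
    (q : S -> quo r) (x : S -> X) (F : T -> S -> Z) :
  weak_hausdorff X -> k_space T -> k_space S ->
  continuous e -> continuous q -> continuous x ->
  (forall s, e (q s) = x s) ->
  (forall t t' s, quo_pi r t = quo_pi r t' -> e (quo_pi r t) = x s ->
     F t s = F t' s) ->
  (forall (V : topologicalType) (b : V -> T) (a : V -> S),
     compact_hausdorff V -> continuous b -> continuous a ->
     (forall v, e (quo_pi r (b v)) = x (a v)) ->
     continuous (fun v => F (b v) (a v))) ->
  continuous (fun s => F (repr (q s)) s).
Proof.
move=> wX kT kS ce cq cx eq Fr Fc; apply: k_space_continuous => // K u cK cu.
apply/continuousP => U oU.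
suff : closed ((fun k => F (repr (q (u k))) (u k)) @^-1` ~` U).
  by rewrite preimage_setC => /closed_openC; rewrite setCK.
move: (~` U) (open_closedC oU) => {oU}U cU.
pose E : set (T * K) := [set p | e (quo_pi r p.1) = x (u p.2)].
pose D : set (T * K) := [set p | E p /\ U (F p.1 (u p.2))].
have cD : open (~` D).
  apply: (k_space_prod kT cK) => L w cL hL cw.
  have cHL : compact_hausdorff L by [].
  have cw1 : continuous (fun l => (w l).1).
    by apply: comp_continuous => //; exact: fst_continuous.
  have cw2 : continuous (fun l => u (w l).2).
    apply: comp_continuous => //; apply: comp_continuous => //.
    exact: snd_continuous.
  (* This is where the weak Hausdorff property enters. *)
  have cE : closed (w @^-1` E).
    apply: (weak_hausdorff_closed_eq wX cHL).
      apply: (comp_continuous ce); apply: comp_continuous cw1.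
      exact: quo_pi_continuous.
    exact: (comp_continuous cx cw2).
  pose V : topologicalType := set_type (w @^-1` E).
  have cV : compact_hausdorff V by exact: compact_hausdorff_closed.
  have ci : continuous (set_val : V -> L) by exact: initial_continuous.
  pose G (v : V) := F (w (set_val v)).1 (u (w (set_val v)).2).
  have cG : continuous G.
    apply: (Fc V (fun v => (w (set_val v)).1) (fun v => u (w (set_val v)).2))
      => //.
    - exact: (comp_continuous cw1 ci).
    - exact: (comp_continuous cw2 ci).
    - by move=> v; exact: (set_mem (valP v)).
  change (open (~` (w @^-1` D))).
  rewrite openC (_ : w @^-1` D = set_val @` (G @^-1` U)).
    apply: compact_closed => //; apply: continuous_compact.
      by apply: continuous_subspaceT.
    apply: subclosed_compact cV.1 _ => //.
    by apply: closed_comp => // v _; exact: cG.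
  apply/seteqP; split=> [l [El Ul]|_ [v Gv <-]].
    by exists (exist _ l (mem_set El)).
  by split=> //; exact: (set_mem (valP v)).
pose D' : set (quo r * K) :=
  [set p | e p.1 = x (u p.2) /\ U (F (repr p.1) (u p.2))].
have cD' : open (~` D').
  apply: quo_prod_open => //.
  rewrite (_ : [set p | _] = ~` D) //; congr (~` _).
  apply/seteqP; split=> -[t k] /= [tk Utk]; split=> //.
    by rewrite (Fr _ (repr (quo_pi r t))) //= /quo_pi reprK.
  by rewrite /= -(Fr t) //= /quo_pi reprK.
rewrite -openC (_ : ~` _ = (fun k => (q (u k), k)) @^-1` (~` D')).
  apply: open_comp => // k _; apply: pair_continuous => y; last exact: cvg_id.
  exact: (comp_continuous cq cu).
apply/seteqP; split=> k nU; first by move=> [_ /nU].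
by move=> Uk; apply: nU; split; [exact: eq|exact: Uk].
Qed.

(** * The unit interval and concatenation *)

Section interval.
Variable R : realType.
Notation I := (unit_interval R).

Definition unit_val (t : I) : R := \val t.

Fact clamp_subproof (r : R) : Num.max 0 (Num.min 1 r) \in [set` `[0 : R, 1]].
Proof.
rewrite inE /= in_itv /= le_max lexx /= ge_max ler01 /=.
by rewrite ge_min lexx.
Qed.

Definition clamp (r : R) : I :=
  exist (fun x => x \in [set` `[0 : R, 1]]) _ (clamp_subproof r).

Lemma unit_val_continuous : continuous unit_val.
Proof. exact: initial_continuous. Qed.

Lemma realD_continuous (V : topologicalType) (f g : V -> R) :
  continuous f -> continuous g -> continuous (fun v => f v + g v).
Proof. by move=> cf cg v; apply: (@continuousD _ R^o V f g v);
  [exact: cf|exact: cg]. Qed.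

Lemma realN_continuous (V : topologicalType) (f : V -> R) :
  continuous f -> continuous (fun v => - f v).
Proof. by move=> cf v; apply: (@continuousN _ R^o V f v); exact: cf. Qed.

Lemma realM_continuous (V : topologicalType) (f g : V -> R) :
  continuous f -> continuous g -> continuous (fun v => f v * g v).
Proof. by move=> cf cg v; apply: (@continuousM R V f g v);
  [exact: cf|exact: cg]. Qed.

Lemma real_min_continuous (V : topologicalType) (f g : V -> R) :
  continuous f -> continuous g -> continuous (fun v => Num.min (f v) (g v)).
Proof. by move=> cf cg v; apply: (@continuous_min R V f g v);
  [exact: cf|exact: cg]. Qed.

Lemma real_max_continuous (V : topologicalType) (f g : V -> R) :
  continuous f -> continuous g -> continuous (fun v => Num.max (f v) (g v)).
Proof. by move=> cf cg v; apply: (@continuous_max R V f g v);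
  [exact: cf|exact: cg]. Qed.

Lemma const_continuous (V Z : topologicalType) (z : Z) :
    continuous (fun _ : V => z).
Proof. by move=> v; exact: cvg_cst. Qed.

Lemma clamp_continuous : continuous clamp.
Proof.
apply: continuous_comp_initial.
apply: real_max_continuous; first exact: const_continuous.
by apply: real_min_continuous;
  [exact: const_continuous|move=> x; exact: cvg_id].
Qed.

Lemma unit_val_ge0 (t : I) : 0 <= unit_val t.
Proof. by have := valP t; rewrite inE /= in_itv /= => /andP[]. Qed.
Lemma unit_val_le1 (t : I) : unit_val t <= 1.
Proof. by have := valP t; rewrite inE /= in_itv /= => /andP[]. Qed.

Lemma unit_val0 : unit_val zero = 0. Proof. by []. Qed.
Lemma unit_val1 : unit_val one = 1. Proof. by []. Qed.

Lemma clampK r : 0 <= r <= 1 -> unit_val (clamp r) = r.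
Proof.
by move=> /andP[r0 r1]; rewrite /unit_val /= (min_idPr r1) (max_idPr r0).
Qed.

Lemma unit_valK t : clamp (unit_val t) = t.
Proof.
by apply/val_inj; apply: clampK; rewrite unit_val_ge0 unit_val_le1.
Qed.

Lemma clamp_le0 r : r <= 0 -> clamp r = zero.
Proof.
move=> r0; apply/val_inj; rewrite /= (min_idPr _) ?(max_idPl _) //.
exact: le_trans ler01.
Qed.
Lemma clamp_ge1 r : 1 <= r -> clamp r = one.
Proof.
by move=> r1; apply/val_inj; rewrite /= (min_idPl r1) (max_idPr ler01).
Qed.

Lemma unit_interval_compact_hausdorff : compact_hausdorff I.
Proof.
split; first exact: unit_interval_compact.
apply: (hausdorff_inj unit_val_continuous val_inj); exact: Rhausdorff.
Qed.

End interval.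

Ltac continuity :=
  lazymatch goal with
  | |- continuous (fun v => @GRing.add _ (@?f v) (@?g v)) =>
      apply: (@realD_continuous _ _ f g); continuity
  | |- continuous (fun v => @GRing.opp _ (@?f v)) =>
      apply: (@realN_continuous _ _ f); continuity
  | |- continuous (fun v => @GRing.mul _ (@?f v) (@?g v)) =>
      apply: (@realM_continuous _ _ f g); continuity
  | |- continuous (fun v => @Order.min _ _ (@?f v) (@?g v)) =>
      apply: (@real_min_continuous _ _ f g); continuity
  | |- continuous (fun v => @Order.max _ _ (@?f v) (@?g v)) =>
      apply: (@real_max_continuous _ _ f g); continuity
  | |- continuous (fun v => unit_val (@?f v)) =>
      apply: (@comp_continuous _ _ _ _ f (@unit_val_continuous _)); continuity
  | |- continuous (fun v => (@?f v, @?g v)) =>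
      apply: (@pair_continuous _ _ _ f g); continuity
  | |- continuous (fun v => fst v) => exact: fst_continuous
  | |- continuous (fun v => snd v) => exact: snd_continuous
  | |- continuous (fun v => fst (@?f v)) =>
      apply: (@comp_continuous _ _ _ _ f (@fst_continuous _ _)); continuity
  | |- continuous (fun v => snd (@?f v)) =>
      apply: (@comp_continuous _ _ _ _ f (@snd_continuous _ _)); continuity
  | |- continuous (fun v => v) => by move=> ?; exact: cvg_id
  | H : continuous ?h |- continuous (fun v => ?h (@?f v)) =>
      apply: (@comp_continuous _ _ _ h f H); continuity
  | |- _ => try (first [assumption | exact: fst_continuous
    | exact: snd_continuous | exact: unit_val_continuous | exact:
    const_continuous])
  end.

(** Concatenation of paths parametrized by the unit interval, as functions of a
    real number: all formulas below are real functions with clamped arguments,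
    which keeps the arithmetic in [R]. *)
Section cat2.
Variable R : realType.
Definition cat2 (Z : Type) (f g : R -> Z) (r : R) : Z :=
  if r <= 2^-1 then f (2 * r) else g (2 * r - 1).

Lemma cat2_continuous (V Z : topologicalType) (F G : V -> R -> Z) (c : V -> R) :
  continuous c -> continuous (fun v => F v (2 * c v)) ->
  continuous (fun v => G v (2 * c v - 1)) -> (forall v, F v 1 = G v 0) ->
  continuous (fun v => cat2 (F v) (G v) (c v)).
Proof.
move=> cc cF cG FG; apply: paste_continuous => // v cv; rewrite cv.
have -> : 2 * 2^-1 = 1 :> R by lra.
by rewrite subrr.
Qed.

Lemma cat2_le (Z : Type) (f g : R -> Z) r : r <= 2^-1 -> cat2 f g r = f (2 * r).
Proof. by rewrite /cat2 => ->. Qed.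

Lemma cat20 (Z : Type) (f g : R -> Z) : cat2 f g 0 = f 0.
Proof. by rewrite cat2_le ?mulr0// invr_ge0. Qed.

Lemma cat21 (Z : Type) (f g : R -> Z) : cat2 f g 1 = g 1.
Proof. by rewrite /cat2 ifF; [congr g; lra|apply/negbTE; rewrite -ltNge; lra].
  Qed.

Lemma eq_cat2 (Z : Type) (f f' g g' : R -> Z) :
  (forall r, 0 <= r <= 1 -> f r = f' r) -> (forall r, 0 <= r <= 1 -> g r = g' r)
    ->
  forall r, 0 <= r <= 1 -> cat2 f g r = cat2 f' g' r.
Proof.
move=> ff gg r /andP[r0 r1]; rewrite /cat2; case: ifPn => [|];
  rewrite -?ltNge => r2.
  by apply: ff; lra.
by apply: gg; lra.
Qed.
End cat2.

(** * Loops, paths and fibre points given by formulas *)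

Section loops.
Variable R : realType.
Notation I := (unit_interval R).

Definition loop_at (X : ptopologicalType) (w : loop R X) (r : R) : X :=
  (w : based_loop R X) (clamp r).

Lemma loop_at_continuous (V : topologicalType) (X : ptopologicalType)
    (w : V -> loop R X) (c : V -> R) :
  continuous w -> continuous c -> continuous (fun v => loop_at (w v) (c v)).
Proof.
move=> cw cc; apply: (@comp_continuous _ _ _ (@ev_fun R X)
  (fun v => (w v, clamp (c v)))).
  exact: ev_continuous.
by apply: pair_continuous => //; apply: comp_continuous cc;
  exact: clamp_continuous.
Qed.

Lemma loop_at_le0 (X : ptopologicalType) (w : loop R X) r : r <= 0 ->
    loop_at w r = point.
Proof. by move=> r0; rewrite /loop_at clamp_le0// path_zero. Qed.

Lemma loop_at_ge1 (X : ptopologicalType) (w : loop R X) r : 1 <= r ->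
    loop_at w r = point.
Proof. by move=> r0; rewrite /loop_at clamp_ge1// path_one. Qed.

Lemma loop_at_point (X : ptopologicalType) r :
    loop_at (point : loop R X) r = point.
Proof. by []. Qed.

Lemma loop_at_map (X Y : ptopologicalType) (f : ptmap X Y) (w : loop R X) r :
  loop_at (loop_map R f w) r = f (loop_at w r).
Proof. by []. Qed.

Lemma eq_loop (X : ptopologicalType) (w w' : loop R X) :
  (forall r, 0 <= r <= 1 -> loop_at w r = loop_at w' r) -> w = w'.
Proof.
move=> ww; apply/path_eqP => t; rewrite -(unit_valK t).
by apply: ww; rewrite unit_val_ge0 unit_val_le1.
Qed.

Section to_loop.
Variables (X : ptopologicalType) (phi : R -> X).

Definition is_loop : Prop :=
  [/\ continuous (phi \o @unit_val R), phi 0 = point & phi 1 = point].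

Let fn : I -> X := if `[< is_loop >] then phi \o @unit_val R else cst point.
Let fn_continuous : continuous fn.
Proof.
rewrite /fn; case: ifPn => [/asboolP[//]|_]; exact: const_continuous.
Qed.
Let fn0 : fn zero = point.
Proof. by rewrite /fn; case: ifPn => // /asboolP[]. Qed.
Let fn1 : fn one = point.
Proof. by rewrite /fn; case: ifPn => // /asboolP[]. Qed.

(** The loop given by a formula [phi] on the unit interval. Being total, it can
    be used inside formulas before the conditions on [phi] are known; its value
    is the constant loop when they fail. *)
Definition to_loop : loop R X := mk_path fn_continuous fn0 fn1.

Lemma loop_at_to_loop r : is_loop -> 0 <= r <= 1 -> loop_at to_loop r = phi r.
Proof.
move=> /asboolP lp r01.
by rewrite -[RHS]/(phi r) -{2}(clampK r01) /loop_at /= /mk_path /fn lp.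
Qed.

Lemma to_loopE t : is_loop -> (to_loop : based_loop R X) t = phi (unit_val t).
Proof. by move=> /asboolP lp; rewrite /= /mk_path /fn lp. Qed.
End to_loop.

Lemma to_loop_eq (X : ptopologicalType) (phi : R -> X) (w : loop R X) :
  (forall r, 0 <= r <= 1 -> phi r = loop_at w r) -> to_loop phi = w.
Proof.
move=> pw; have wE t : phi (unit_val t) = (w : based_loop R X) t.
  by rewrite pw ?unit_val_ge0 ?unit_val_le1// /loop_at unit_valK.
have lp : is_loop phi.
  split; last 2 first.
  - by rewrite pw ?lexx ?ler01// loop_at_le0.
  - by rewrite pw ?lexx ?ler01// loop_at_ge1.
  rewrite (_ : phi \o _ = (w : based_loop R X)); last exact/funext.
  exact: cts_fun.
by apply/path_eqP => t; rewrite [LHS]to_loopE.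
Qed.

Lemma eq_to_loop (X : ptopologicalType) (phi psi : R -> X) :
  (forall r, 0 <= r <= 1 -> phi r = psi r) -> to_loop phi = to_loop psi.
Proof.
move=> pw; have wE : phi \o @unit_val R = psi \o @unit_val R.
  by apply/funext => t; apply: pw; rewrite unit_val_ge0 unit_val_le1.
have lE : is_loop phi = is_loop psi.
  by rewrite /is_loop wE !pw ?lexx ?ler01.
by apply/path_eqP => t /=; rewrite /mk_path lE wE.
Qed.

Lemma to_loop_continuous (V : topologicalType) (X : ptopologicalType)
    (phi : V -> R -> X) : k_space V ->
  continuous (fun p : V * I => phi p.1 (unit_val p.2)) ->
  (forall v, phi v 0 = point) -> (forall v, phi v 1 = point) ->
  continuous (fun v => to_loop (phi v)).
Proof.
move=> kV cphi p0 p1; have [cc cv] := continuous_curry cphi.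
apply: kify_lift_continuous => //; apply: continuous_comp_initial.
rewrite (_ : _ \o _ = curry (fun p : V * I => phi p.1 (unit_val p.2))) //.
apply/funext => v; apply/funext => t /=.
by apply: to_loopE; split=> //; exact: cv.
Qed.

End loops.

Section paths.
Variables (R : realType) (A X : ptopologicalType) (f : ptmap A X).
Notation I := (unit_interval R).

Definition ps_pt (y : path_space R f) : A := (\val (y : path_pullback R f)).1.
Definition ps_at (y : path_space R f) (r : R) : X :=
  ((\val (y : path_pullback R f)).2 : continuousType I X) (clamp r).

Lemma ps_pt_continuous : continuous ps_pt.
Proof.
have c1 : continuous (\val : path_pullback R f -> A * free_path R X).
  exact: initial_continuous.
apply: (comp_continuous (@fst_continuous _ _)).
exact: (comp_continuous c1 (@kify_id_continuous (path_pullback R f))).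
Qed.

Lemma ps_at_continuous (V : topologicalType) (y : V -> path_space R f)
    (c : V -> R) :
  continuous y -> continuous c -> continuous (fun v => ps_at (y v) (c v)).
Proof.
move=> cy cc.
have c1 : continuous (\val : path_pullback R f -> A * free_path R X).
  exact: initial_continuous.
have c2 : continuous
    (fun w : free_path R X => (w : continuousType I X) : {compact-open, I
      -> X}).
  exact: initial_continuous.
have c3 := comp_continuous c2 (comp_continuous (@snd_continuous _ _) c1).
have c4 := comp_continuous c3 (@kify_id_continuous (path_pullback R f)).
have c5 := @path_eval_continuous R _ X _ (comp_continuous c4 cy)
  (fun v => @cts_fun _ _ _).
apply: (@comp_continuous _ _ _ _ (fun v => (v, clamp (c v))) c5).
apply: pair_continuous => [v|]; first exact: cvg_id.
by apply: comp_continuous cc; exact: clamp_continuous.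
Qed.

Lemma ps_at0 y r : r <= 0 -> ps_at y r = f (ps_pt y).
Proof. by move=> r0; rewrite /ps_at clamp_le0//;
  exact: (set_mem (valP (y : path_pullback R f))). Qed.

Lemma ps_at1 y r : 1 <= r -> ps_at y r = path_fibration R f y.
Proof. by move=> r1; rewrite /ps_at clamp_ge1. Qed.

Lemma ps_pt_point : ps_pt point = point. Proof. by []. Qed.
Lemma eq_path_space (y z : path_space R f) : ps_pt y = ps_pt z ->
  (forall r, 0 <= r <= 1 -> ps_at y r = ps_at z r) -> y = z.
Proof.
move=> e1 e2; apply: (@val_inj _ _ (path_pullback R f)).
rewrite [LHS]surjective_pairing [RHS]surjective_pairing; congr pair => //.
apply/continuousEP => t; rewrite -(unit_valK t); apply: e2.
by rewrite unit_val_ge0 unit_val_le1.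
Qed.

Section to_path.
Variables (a : A) (phi : R -> X).

Definition is_path : Prop := continuous (phi \o @unit_val R) /\ phi 0 = f a.

(** As for loops, a total constructor with a default value, here for the points
    of the total space of the fibration associated to [f]. *)
Definition to_path_fun : I -> X :=
  if `[< is_path >] then phi \o @unit_val R else cst (f a).

Lemma to_path_fun_continuous : continuous to_path_fun.
Proof.
rewrite /to_path_fun; case: ifPn => [/asboolP[//]|_]; exact: const_continuous.
Qed.

HB.instance Definition _ :=
  isContinuous.Build I X to_path_fun to_path_fun_continuous.

Fact to_path_subproof :
  (a, (to_path_fun : continuousType I X) : free_path R X) \in path_pullback_set
    f.
Proof.
rewrite inE /path_pullback_set /= /to_path_fun; by case: ifPn => // /asboolP[_].
Qed.

Definition to_path : path_space R f :=
  (exist (fun p => p \in path_pullback_set f) _ to_path_subproof : path_pullback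
    R f).

Lemma to_path_at r : is_path -> 0 <= r <= 1 -> ps_at to_path r = phi r.
Proof.
move=> /asboolP lp r01.
by rewrite -[RHS]/(phi r) -{2}(clampK r01) /ps_at /= /to_path_fun lp.
Qed.
End to_path.

Lemma to_path_continuous (V : topologicalType) (a : V -> A) (phi : V -> R -> X)
    :
  k_space V -> continuous a ->
  continuous (fun p : V * I => phi p.1 (unit_val p.2)) ->
  (forall v, phi v 0 = f (a v)) ->
  continuous (fun v => to_path (a v) (phi v)).
Proof.
move=> kV ca cphi p0; have [cc cv] := continuous_curry cphi.
apply: kify_lift_continuous => //; apply: continuous_comp_initial.
rewrite (_ : _ \o _ = fun v => (a v, (to_path_fun (a v) (phi v) : continuousType
  I X) : free_path R X)) //.
apply: pair_continuous => //; apply: continuous_comp_initial.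
rewrite (_ : _ \o _ = curry (fun p : V * I => phi p.1 (unit_val p.2))) //.
apply/funext => v; apply/funext => t /=.
have /asboolP lp : is_path (a v) (phi v) by split=> //; exact: cv.
by rewrite /to_path_fun lp.
Qed.

Lemma eq_to_path (a : A) (phi : R -> X) (y : path_space R f) :
  ps_pt y = a -> (forall r, 0 <= r <= 1 -> phi r = ps_at y r) ->
    to_path a phi = y.
Proof.
move=> ya pw; have wE t :
  phi (unit_val t) = ((\val (y : path_pullback R f)).2 : continuousType I X) t.
  by rewrite pw ?unit_val_ge0 ?unit_val_le1// /ps_at unit_valK.
have lp : is_path a phi.
  split; last by rewrite pw ?lexx ?ler01// ps_at0// ya.
  rewrite (_ : phi \o _ = ((\val (y : path_pullback R f)).2 : continuousType I
    X)); last exact/funext.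
  exact: cts_fun.
by apply: eq_path_space => // r r01; rewrite to_path_at// pw.
Qed.

End paths.

Section fibre.
Variables (G X : ptopologicalType) (p : ptmap G X).

Definition to_fibre (g : G) : fibre p :=
  (insubd (point : fibre_carrier p) g : fibre_carrier p).

Lemma fibre_incl_to_fibre g : p g = point -> fibre_incl p (to_fibre g) = g.
Proof. by move=> pg; rewrite /fibre_incl /= /fibre_incl_fun /to_fibre insubdK//
  inE. Qed.

Lemma to_fibre_incl y : to_fibre (fibre_incl p y) = y.
Proof. exact: (@valKd _ _ (fibre_carrier p)). Qed.

Lemma to_fibre_point : to_fibre point = point.
Proof. by rewrite -[RHS]to_fibre_incl ptmap_point. Qed.

Lemma to_fibre_continuous (V : topologicalType) (g : V -> G) :
  k_space V -> continuous g -> (forall v, p (g v) = point) ->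
  continuous (fun v => to_fibre (g v)).
Proof.
move=> kV cg pg; apply: kify_lift_continuous => //.
apply: continuous_comp_initial; rewrite (_ : _ \o _ = g) //.
by apply/funext => v; exact: fibre_incl_to_fibre.
Qed.
End fibre.

(** * Homotopies, suspensions and the 1-simplex *)

Section homotopies.
Variable R : realType.
Notation I := (unit_interval R).

Lemma homotopic_ext (X Y : ptopologicalType) (f g : ptmap X Y) :
  (forall x, f x = g x) -> homotopic R f g.
Proof.
move=> fg; exists (fun p => f p.1); split=> // [|t /=]; last exact: ptmap_point.
by apply: comp_continuous (@ptmap_continuous _ _ f) (@fst_continuous _ _).
Qed.

Lemma homotopic_sym (X Y : ptopologicalType) (f g : ptmap X Y) :
  homotopic R f g -> homotopic R g f.
Proof.
move=> [H [cH H0 H1 Hp]]; exists (fun p => H (p.1, clamp (1 - unit_val p.2))).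
split=> [|x|x|t] //=.
- apply: (comp_continuous cH (f := fun p => (p.1, clamp (1 - unit_val p.2)))).
  apply: pair_continuous; first exact: fst_continuous.
  apply: (comp_continuous (@clamp_continuous R) (f := fun p => 1 - unit_val
    p.2)).
  by continuity.
- by rewrite unit_val0 subr0 clamp_ge1.
- by rewrite unit_val1 subrr clamp_le0.
Qed.

Lemma homotopic_trans (X Y : ptopologicalType) (f g h : ptmap X Y) :
  homotopic R f g -> homotopic R g h -> homotopic R f h.
Proof.
move=> [H [cH H0 H1 Hp]] [K [cK K0 K1 Kp]].
exists (fun p => cat2 (fun r => H (p.1, clamp r)) (fun r => K (p.1, clamp r))
  (unit_val p.2)).
have cc (c : X * I -> R) : continuous c ->
    continuous (fun p : X * I => (p.1, clamp (c p))).
  move=> ?; apply: pair_continuous; first exact: fst_continuous.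
  by apply: (comp_continuous (@clamp_continuous R)).
split=> [|x|x|t] /=.
- apply: cat2_continuous => [|||p]; first by continuity.
  + by apply: (comp_continuous cH
    (f := fun p => (p.1, clamp (2 * unit_val p.2)))); apply: cc; continuity.
  + by apply: (comp_continuous cK
    (f := fun p => (p.1, clamp (2 * unit_val p.2 - 1)))); apply: cc; continuity.
  + by rewrite clamp_ge1// clamp_le0// H1 K0.
- by rewrite unit_val0 cat20 clamp_le0.
- by rewrite unit_val1 cat21 clamp_ge1.
- by rewrite /cat2; case: ifP; rewrite ?Hp ?Kp.
Qed.

Lemma homotopic_precomp (W X Y : ptopologicalType) (e : ptmap W X)
    (f g : ptmap X Y) :
  homotopic R f g -> homotopic R (ptcomp f e) (ptcomp g e).
Proof.
move=> [H [cH H0 H1 Hp]]; exists (fun p => H (e p.1, p.2));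
  split=> [|x|x|t] //=.
- apply: (comp_continuous cH (f := fun p => (e p.1, p.2))).
  apply: pair_continuous; last exact: snd_continuous.
  by apply: comp_continuous (@ptmap_continuous _ _ e) (@fst_continuous _ _).
- by rewrite ptmap_point.
Qed.

End homotopies.

Lemma quo_repr_prod_continuous (T : ptopologicalType) (r : T -> T -> Prop)
    (K Z : topologicalType) (F : T * K -> Z) :
  compact_hausdorff K -> continuous F ->
  (forall x y k, r x y -> F (x, k) = F (y, k)) ->
  continuous (fun p : quo r * K => F (repr p.1, p.2)).
Proof.
move=> cK cF Fr; apply: quo_prod_continuous => //.
rewrite (_ : (fun _ => _) = F) //; apply/funext => -[x k] /=.
have Fpi a b : quo_pi r a = quo_pi r b -> F (a, k) = F (b, k).
  by move=> /eqmodP/asboolP; elim=> // [? ? /Fr|? ? ? _ -> _ ->].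
by apply: Fpi; rewrite /quo_pi reprK.
Qed.

Section suspension.
Variables (R : realType).
Notation I := (unit_interval R).

Definition susp_at (Y : ptopologicalType) (y : Y) (r : R) : susp R Y :=
  susp_pi R Y (y, clamp r).

Lemma susp_at_continuous (V : topologicalType) (Y : ptopologicalType)
    (y : V -> Y) (c : V -> R) :
  continuous y -> continuous c -> continuous (fun v => susp_at (y v) (c v)).
Proof.
move=> cy cc; apply: (comp_continuous (@ptmap_continuous _ _ (susp_pi R Y))
  (f := fun v => (y v, clamp (c v)))).
by apply: pair_continuous => //; apply: comp_continuous cc;
  exact: clamp_continuous.
Qed.

Lemma susp_base_point (Y : ptopologicalType) (p : Y * I) :
  susp_base p -> susp_pi R Y p = point.
Proof. by move=> bp; apply: quo_piP; split=> //; exact: Or31. Qed.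

Lemma susp_at_le0 (Y : ptopologicalType) (y : Y) r : r <= 0 ->
    susp_at y r = point.
Proof. by move=> r0; apply: susp_base_point; rewrite clamp_le0//;
  exact: Or32. Qed.
Lemma susp_at_ge1 (Y : ptopologicalType) (y : Y) r : 1 <= r ->
    susp_at y r = point.
Proof. by move=> r0; apply: susp_base_point; rewrite clamp_ge1//;
  exact: Or33. Qed.
Lemma susp_at_point (Y : ptopologicalType) r : susp_at (point : Y) r = point.
Proof. by apply: susp_base_point; exact: Or31. Qed.

Lemma ev_susp_at (X : ptopologicalType) (w : loop R X) r :
  ev R X (susp_at w r) = loop_at w r.
Proof. exact: evE. Qed.

Lemma susp_map_at (Y Z : ptopologicalType) (f : ptmap Y Z) y r :
  susp_map R f (susp_at y r) = susp_at (f y) r.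
Proof. exact: susp_mapE. Qed.

Lemma susp_at_surj (Y : ptopologicalType) (q : susp R Y) :
  exists y r, 0 <= r <= 1 /\ q = susp_at y r.
Proof.
have [[y t] ->] := quo_surj q; exists y, (unit_val t).
by rewrite unit_val_ge0 unit_val_le1 /susp_at unit_valK.
Qed.

Definition susp_unit (Y : ptopologicalType) (y : Y) : loop R (susp R Y) :=
  to_loop (susp_at y).

Lemma susp_unit_at (Y : ptopologicalType) (y : Y) r :
  loop_at (susp_unit y) r = susp_at y r.
Proof.
have [r0|/ltW r0] := leP r 0; first by rewrite loop_at_le0 ?susp_at_le0.
have [r1|/ltW r1] := leP 1 r; first by rewrite loop_at_ge1 ?susp_at_ge1.
rewrite loop_at_to_loop ?r0 ?r1//; split;
  [|exact: susp_at_le0|exact: susp_at_ge1].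
by apply: (susp_at_continuous (y := fun=> y));
  [exact: const_continuous|exact: unit_val_continuous].
Qed.

Lemma susp_unit_continuous (V : topologicalType) (Y : ptopologicalType)
    (y : V -> Y) :
  k_space V -> continuous y -> continuous (fun v => susp_unit (y v)).
Proof.
move=> kV cy; apply: to_loop_continuous => // [|v|v].
- by apply: susp_at_continuous; continuity.
- exact: susp_at_le0.
- exact: susp_at_ge1.
Qed.

Lemma susp_unit_point (Y : ptopologicalType) : susp_unit (point : Y) = point.
Proof. by apply: to_loop_eq => r _; rewrite susp_at_point. Qed.

Lemma loop_map_ev_unit (X : ptopologicalType) (w : loop R X) :
  loop_map R (ev R X) (susp_unit w) = w.
Proof.
by apply: eq_loop => r _; rewrite loop_at_map susp_unit_at ev_susp_at.
Qed.

Lemma k_space_loop (X : ptopologicalType) : k_space (loop R X).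
Proof. exact: k_space_kify. Qed.

Lemma k_space_susp (Y : ptopologicalType) : k_space Y -> k_space (susp R Y).
Proof.
move=> kY; apply/k_space_quo/k_space_prod => //.
exact: unit_interval_compact_hausdorff.
Qed.

End suspension.

Section edge.
Variable R : realType.

Definition bary0 (t : simplex R 1) : R := (\val t) ord0 ord0.

Lemma bary0_continuous : continuous bary0.
Proof.
apply: (@comp_continuous _ _ _ (fun M : 'rV[R]_2 => M ord0 ord0)
  (\val : simplex R 1 -> _)).
  exact: coord_continuous.
exact: initial_continuous.
Qed.

Definition edge_row (r : R) : 'rV[R]_2 :=
  r *: delta_mx ord0 ord0 + (1 - r) *: delta_mx ord0 ord_max.

Fact edge_subproof (t : unit_interval R) :
    edge_row (unit_val t) \in @simplex_set R 1.
Proof.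
have t0 := unit_val_ge0 t; have t1 := unit_val_le1 t.
rewrite inE; split=> [i|].
  rewrite !mxE; apply: addr_ge0; apply: mulr_ge0 => //; rewrite ?subr_ge0//.
by rewrite !big_ord_recl big_ord0 !mxE /=; lra.
Qed.

(** The point with barycentric coordinates [r] and [1 - r]: with this
    orientation the coface 0 is [edge 0] and the coface 1 is [edge 1]. *)
Definition edge (r : R) : simplex R 1 :=
  exist (fun x => x \in @simplex_set R 1) _ (edge_subproof (clamp r)).

Lemma edge_continuous : continuous edge.
Proof.
apply: continuous_comp_initial.
apply: (comp_continuous (f := fun r => unit_val (clamp r)) (g := edge_row));
  last first.
  exact: comp_continuous (@unit_val_continuous R) (@clamp_continuous R).
have cZ (c : R -> R) (v : 'rV[R]_2) : continuous c ->
  continuous (fun r => c r *: v).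
  by move=> cc r; apply: (@continuousZr_tmp R 'rV[R]_2 R c v r); exact: cc.
move=> r; apply: (@continuousD R 'rV[R]_2 R); apply: cZ; continuity.
Qed.

Lemma bary0_edge r : 0 <= r <= 1 -> bary0 (edge r) = r.
Proof. by move=> r01; rewrite /bary0 /= !mxE /= clampK//; lra. Qed.

Lemma bary0_bound t : 0 <= bary0 t <= 1.
Proof.
have [t0 t1] := set_mem (valP t).
rewrite !big_ord_recl big_ord0 addr0 in t1.
by rewrite t0 -t1 lerDl t0.
Qed.

Lemma edge_bary0 t : edge (bary0 t) = t.
Proof.
have [t0 t1] := set_mem (valP t).
rewrite !big_ord_recl big_ord0 addr0 in t1.
have t1' : bary0 t + (\val t) ord0 (lift ord0 ord0) = 1 by [].
have b01 := bary0_bound t.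
apply/val_inj => /=; apply/rowP => i; rewrite /edge_row clampK// !mxE /=.
have [->|->] : i = ord0 \/ i = lift ord0 ord0.
- by case: i => -[|[|//]] lt; [left|right]; apply/val_inj.
- by rewrite /= mulr1 mulr0 addr0.
- by rewrite /= mulr0 mulr1 add0r -t1' addrAC subrr add0r.
Qed.

Lemma bary0_coface0 (t : simplex R 0) : bary0 (coface ord0 t) = 0.
Proof. by rewrite /bary0 /= mxE unlift_none. Qed.

Lemma bary0_coface1 (t : simplex R 0) : bary0 (coface ord_max t) = 1.
Proof.
have [_] := set_mem (valP t); rewrite big_ord_recl big_ord0 addr0 => t1.
rewrite /bary0 /= mxE; case: unliftP => [j|//] jE.
by rewrite -t1; congr (\val t _ _); apply/val_inj; case: j jE => -[].
Qed.
End edge.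

(** * The realization through dimension 1 *)

Section realization1.
Variables (R : realType) (X : ptopologicalType).
Notation I := (unit_interval R).
Notation L1 := (realization R (Lambda R X) 1).

Definition vert (q : susp_loop R X) : L1 := realization_incl R (Lambda R X) 0 q.

(** The edges of the realization are indexed by the points [susp_at w t]; the
    variable [h] runs along the edge. *)
Definition cell (w : loop R (susp_loop R X)) (t h : R) : L1 :=
  realization_chi R (Lambda R X) 1
    (half_smash_pi (susp_loop R (susp_loop R X)) (simplex R 1)
      (susp_at w t, edge h)).

Lemma vert_continuous : continuous vert.
Proof. exact: ptmap_continuous. Qed.

Lemma vert_point : vert point = point.
Proof. exact: ptmap_point. Qed.

Lemma cell_continuous (V : topologicalType) (w : V -> loop R (susp_loop R X))
    (t h : V -> R) :
  continuous w -> continuous t -> continuous h ->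
  continuous (fun v => cell (w v) (t v) (h v)).
Proof.
move=> cw ct ch.
apply: (comp_continuous (@ptmap_continuous _ _ (realization_chi R (Lambda R X)
  1))
  (f := fun v => half_smash_pi (susp_loop R (susp_loop R X)) (simplex R 1)
    (susp_at (w v) (t v), edge (h v)))).
apply: (comp_continuous (@ptmap_continuous _ _ (half_smash_pi
  (susp_loop R (susp_loop R X)) (simplex R 1))) (f := fun v => (susp_at (w v)
  (t v), edge (h v)))).
apply: pair_continuous; first exact: susp_at_continuous.
by apply: comp_continuous ch; exact: edge_continuous.
Qed.

(** The end of the edge given by the face [d_0], which evaluates the loop. *)
Lemma cell_h0 w t : cell w t 0 = vert (loop_at w t).
Proof.
apply/esym; apply: glueP; exists ord0, (susp_at w t), point; split.
  rewrite -[LHS](ev_susp_at w t); exact: (esym (half_smash_fstE _ _)).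
by congr (half_smash_pi _ _ (_, _)); rewrite -[RHS]edge_bary0 bary0_coface0.
Qed.

(** The end of the edge given by the face [d_1], which maps the loop to [X] and
    suspends it again. *)
Lemma cell_h1 w t : cell w t 1 = vert (susp_at (loop_map R (ev R X) w) t).
Proof.
apply/esym; apply: glueP; exists ord_max, (susp_at w t), point; split.
  have := susp_map_at (loop_map R (ev R X)) w t.
  move=> <-; exact: (esym (half_smash_fstE _ _)).
by congr (half_smash_pi _ _ (_, _)); rewrite -[RHS]edge_bary0 bary0_coface1.
Qed.

Lemma cell_base w t h : susp_at w t = point -> cell w t h = point.
Proof.
by move=> e; rewrite /cell e half_smash_point;
  exact: (ptmap_point (realization_chi R (Lambda R X) 1)).
Qed.

Lemma canonical_vert q : canonical_map R (Lambda R X) 1 (vert q) = ev R X q.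
Proof. exact: canonical_map_incl. Qed.

Lemma canonical_cell w t h :
  canonical_map R (Lambda R X) 1 (cell w t h) = ev R X (loop_at w t).
Proof.
rewrite /cell canonical_map_chi half_smash_fstE /=.
by rewrite -[RHS](congr1 (ev R X) (ev_susp_at w t)).
Qed.

Lemma realization1_ind (P : L1 -> Prop) :
  (forall q, P (vert q)) ->
  (forall w t h, 0 <= t <= 1 -> 0 <= h <= 1 -> P (cell w t h)) -> forall z, P z.
Proof.
move=> Pv Pc z; have [[[] q] ->] := quo_surj z; first exact: Pv.
have [[y t] ->] := quo_surj q.
have [w [r [r01 ->]]] := susp_at_surj y.
by rewrite -(edge_bary0 t); apply: Pc => //; exact: bary0_bound.
Qed.

Section lift.
Variables (Z : ptopologicalType) (f : ptmap (susp_loop R X) Z)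
  (g : loop R (susp_loop R X) -> R -> R -> Z).
Hypothesis cg : continuous (fun p : (loop R (susp_loop R X) * I) * I =>
  g p.1.1 (unit_val p.1.2) (unit_val p.2)).
Hypothesis gt0 : forall w h, 0 <= h <= 1 -> g w 0 h = point.
Hypothesis gt1 : forall w h, 0 <= h <= 1 -> g w 1 h = point.
Hypothesis gp : forall t h, 0 <= t <= 1 -> 0 <= h <= 1 -> g point t h = point.
Hypothesis gh0 : forall w t, 0 <= t <= 1 -> g w t 0 = f (loop_at w t).
Hypothesis gh1 : forall w t, 0 <= t <= 1 ->
  g w t 1 = f (susp_at (loop_map R (ev R X) w) t).

Lemma realization1_lift : exists F : ptmap L1 Z,
  (forall q, F (vert q) = f q) /\
  (forall w t h, 0 <= t <= 1 -> 0 <= h <= 1 -> F (cell w t h) = g w t h).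
Proof.
pose S2 := susp_loop R (susp_loop R X).
have v01 (t : I) : 0 <= unit_val t <= 1 by rewrite unit_val_ge0 unit_val_le1.
pose F0 (p : (loop R (susp_loop R X) * I) * I) :=
  g p.1.1 (unit_val p.1.2) (unit_val p.2).
have F0b p h : susp_base p -> F0 (p, h) = point.
  by case: p => w t [] /= e; rewrite /F0 /= e ?gp ?gt0 ?gt1.
have F0r x y k : pinch (@susp_base R (loop R (susp_loop R X))) x y ->
  F0 (x, k) = F0 (y, k).
  by move=> [/F0b-> /F0b->].
pose F1 (p : S2 * simplex R 1) : Z := F0 (repr p.1, clamp (bary0 p.2)).
have F1E w t h : 0 <= t <= 1 -> 0 <= h <= 1 ->
  F1 (susp_at w t, edge h) = g w t h.
  move=> t01 h01; rewrite /F1 /= bary0_edge//.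
  have : quo_pi (pinch (@susp_base R (loop R (susp_loop R X))))
    (repr (susp_at w t)) = susp_at w t by rewrite /quo_pi reprK.
  move=> /quo_pinchP [->|[b1 b2]]; first by rewrite /F0 /= !clampK.
  by rewrite F0b// -(F0b (w, clamp t) (clamp h) b2) /F0 /= !clampK.
have cF1 : continuous F1.
  apply: (comp_continuous (quo_repr_prod_continuous
    (unit_interval_compact_hausdorff R) cg F0r) (f := fun p :
    S2 * simplex R 1 => (p.1, clamp (bary0 p.2)))).
  apply: pair_continuous; first exact: fst_continuous.
  apply: (comp_continuous (@clamp_continuous R) (f := fun p : S2 * simplex R 1
    => bary0 p.2)).
  by apply: (comp_continuous (@bary0_continuous R)); exact: snd_continuous.
have F1p t : F1 (point, t) = point.
  have -> : (point : S2) = susp_at point 0 by rewrite susp_at_point.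
  rewrite -(edge_bary0 t) F1E ?lexx ?ler01 ?bary0_bound// gp ?lexx ?ler01//.
  exact: bary0_bound.
pose F1m : ptmap (S2 * simplex R 1)%type Z := PtMap cF1 (F1p point).
have F1mr p q : pinch (@half_smash_base S2 (simplex R 1)) p q -> F1m p = F1m q.
  by case: p q => p s [q t] [e1 e2]; move: e1 e2;
    rewrite /half_smash_base /= => -> ->; rewrite !F1p.
pose F2 : ptmap (half_smash S2 (simplex R 1)) Z := quo_lift F1mr.
have fF2 a b : face_glue (realization_chi R (Lambda R X) 0) a b -> f a = F2 b.
  move=> [i [x [t [-> ->]]]].
  have F2E : F2 (half_smash_pi S2 (simplex R 1) (x, coface i t)) = F1
    (x, coface i t).
    exact: (quo_liftE F1mr (x, coface i t)).
  rewrite [RHS]F2E {F2E}.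
  have -> : realization_chi R (Lambda R X) 0 (half_smash_pi _ _
    (fs_face (Lambda R X) 0 i x, t)) = fs_face (Lambda R X) 0 i x.
    exact: half_smash_fstE.
  have [w [r [r01 xE]]] := susp_at_surj x.
  case: i => -[|[|//]] lti.
    rewrite (_ : Ordinal lti = ord0); last exact/val_inj.
    have -> : coface ord0 t = edge 0 by rewrite -[LHS]edge_bary0 bary0_coface0.
    rewrite xE F1E ?lexx ?ler01// gh0//; congr (f _); exact: ev_susp_at.
  rewrite (_ : Ordinal lti = ord_max); last exact/val_inj.
  have -> : coface ord_max t = edge 1 by rewrite -[LHS]edge_bary0 bary0_coface1.
  by rewrite xE F1E ?lexx ?ler01// gh1//; congr (f _); exact: susp_map_at.
exists (glue_lift fF2); split=> [q|w t h t01 h01].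
  exact: (glue_lift_leftE fF2 q).
have := glue_lift_rightE (face_glue_point (realization_chi R (Lambda R X) 0))
  fF2 (half_smash_pi S2 (simplex R 1) (susp_at w t, edge h)).
by move=> e; rewrite [LHS]e -F1E//;
  exact: (quo_liftE F1mr (susp_at w t, edge h)).
Qed.
End lift.
End realization1.

(** * From the realization to the second Ganea space *)

Section to_ganea.
Variables (R : realType) (X : ptopologicalType).
Notation I := (unit_interval R).
Notation SX := (susp_loop R X).
Notation G1 := (path_space R (ev R X)).
Notation p1 := (path_fibration R (ev R X)).
Notation M := (mapping_cone R (fibre_incl p1)).
Notation evl := (loop_map R (ev R X)).

Definition cone_left (y : G1) : M :=
    glue_left_fun (attach (R := R) (fibre_incl p1)) y.
Definition cone_right (y : fibre p1) (t : R) : M :=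
  glue_right_fun (attach (R := R) (fibre_incl p1)) (cone_pi R (fibre p1)
    (y, clamp t)).

Lemma cone_right0 y : cone_right y 0 = cone_left (fibre_incl p1 y).
Proof. by apply/esym/glueP; exists y; rewrite clamp_le0. Qed.

Lemma cone_pi_base (p : fibre p1 * I) : cone_base p ->
    cone_pi R (fibre p1) p = point.
Proof. by move=> bp; apply: quo_piP; split=> //; left. Qed.

Lemma cone_right_base y t : y = point \/ 1 <= t -> cone_right y t = point.
Proof.
move=> yt; rewrite /cone_right cone_pi_base.
  exact: (glue_right_point (attach_point R (fibre_incl p1))).
by case: yt => [->|t1]; [left|right; rewrite /= clamp_ge1].
Qed.

Lemma ganea_cone_left y : ganea_cone R p1 (cone_left y) = p1 y.
Proof. exact: (glue_lift_leftE (@ganea_cone_subproof R G1 X p1)). Qed.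

Lemma ganea_cone_right y t : ganea_cone R p1 (cone_right y t) = point.
Proof.
exact: (glue_lift_rightE (attach_point R (fibre_incl p1))
  (@ganea_cone_subproof R G1 X p1)).
Qed.

Lemma cone_left_continuous : continuous cone_left.
Proof. exact: glue_left_continuous. Qed.

Lemma cone_right_continuous (V : topologicalType) (y : V -> fibre p1)
    (t : V -> R) :
  continuous y -> continuous t -> continuous (fun v => cone_right (y v) (t v)).
Proof.
move=> cy ct.
apply: (comp_continuous (@glue_right_continuous _ _ (attach (R := R)
  (fibre_incl p1)))
  (f := fun v => cone_pi R (fibre p1) (y v, clamp (t v)))).
apply: (comp_continuous (@ptmap_continuous _ _ (cone_pi R (fibre p1)))
  (f := fun v => (y v, clamp (t v)))).
by apply: pair_continuous => //; apply: comp_continuous ct;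
  exact: clamp_continuous.
Qed.

(** The path runs backwards along the image of [w] in [X], from time [s] for the
    proportion [t] of the way to time 0. For [t = 1] it ends at the base point,
    which puts the point in the fibre. *)
Definition lag (w : loop R SX) (s t : R) : G1 :=
  to_path (ev R X) (loop_at w s) (fun u => loop_at (evl w) (s * (1 - u * t))).

Lemma k_space_prodI (V : topologicalType) : k_space V -> k_space (V * I)%type.
Proof. by move=> kV; apply: k_space_prod => //;
  exact: unit_interval_compact_hausdorff. Qed.

Lemma loop_map_continuous_comp (V : topologicalType) (A B : ptopologicalType)
    (f : ptmap A B) (w : V -> loop R A) :
  continuous w -> continuous (fun v => loop_map R f (w v)).
Proof. by move=> cw; exact: comp_continuous (@ptmap_continuous _ _
  (loop_map R f)) cw. Qed.

Lemma lag_path_continuous (V : topologicalType) (w : V -> loop R SX)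
    (s t : V -> R) :
  continuous w -> continuous s -> continuous t ->
  continuous (fun p : V * I => loop_at (evl (w p.1))
    (s p.1 * (1 - unit_val p.2 * t p.1))).
Proof.
move=> cw cs ct; apply: loop_at_continuous; last by continuity.
apply: loop_map_continuous_comp; continuity.
Qed.

Lemma lag_continuous (V : topologicalType) (w : V -> loop R SX) (s t : V -> R) :
  k_space V -> continuous w -> continuous s -> continuous t ->
  continuous (fun v => lag (w v) (s v) (t v)).
Proof.
move=> kV cw cs ct; apply: to_path_continuous => // [||v].
- exact: loop_at_continuous.
- exact: lag_path_continuous.
- by rewrite mul0r subr0 mulr1.
Qed.

Lemma lag_at w s t r : 0 <= r <= 1 -> ps_at (lag w s t) r = loop_at (evl w)
    (s * (1 - r * t)).
Proof.
move=> r01; rewrite to_path_at//; split; last by rewrite mul0r subr0 mulr1.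
have cu : continuous (fun u : I => s * (1 - unit_val u * t)) by continuity.
by apply: loop_at_continuous => //; exact: const_continuous.
Qed.

Lemma lag_fibre w s : p1 (lag w s 1) = point.
Proof.
rewrite -(ps_at1 _ (lexx 1)) lag_at ?lexx ?ler01//.
by rewrite loop_at_le0// mul1r subrr mulr0.
Qed.

Lemma p1_lag w s t : p1 (lag w s t) = loop_at (evl w) (s * (1 - t)).
Proof. by rewrite -(ps_at1 _ (lexx 1)) lag_at ?lexx ?ler01// mul1r. Qed.

(** The contraction of the point [w s]: into the fibre while [t <= 1], then up
    the cone until [t = 2]. *)
Definition contr (w : loop R SX) (s t : R) : M :=
  if t <= 1 then cone_left (lag w s t)
  else cone_right (to_fibre p1 (lag w s 1)) (t - 1).

Lemma contr_continuous (V : topologicalType) (w : V -> loop R SX) (s t : V -> R)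
    :
  k_space V -> continuous w -> continuous s -> continuous t ->
  continuous (fun v => contr (w v) (s v) (t v)).
Proof.
move=> kV cw cs ct; apply: paste_continuous => // [||v ->].
- apply: (comp_continuous cone_left_continuous (f := fun v => lag (w v) (s v)
  (t v))).
  exact: lag_continuous.
- apply: cone_right_continuous; last by continuity.
  apply: to_fibre_continuous => // [|v]; last exact: lag_fibre.
  by apply: lag_continuous => //; exact: const_continuous.
- by rewrite subrr cone_right0 fibre_incl_to_fibre// lag_fibre.
Qed.

Lemma ganea_cone_contr w s t :
  ganea_cone R p1 (contr w s t) = loop_at (evl w) (s * (1 - Num.min t 1)).
Proof.
rewrite /contr; case: (leP t 1) => t1.
  by rewrite ganea_cone_left p1_lag.
by rewrite ganea_cone_right loop_at_le0// subrr mulr0.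
Qed.

Lemma lag_eq_point w s t : loop_at w s = point ->
  (forall r, 0 <= r <= 1 -> loop_at (evl w) (s * (1 - r * t)) = point) ->
  lag w s t = point.
Proof.
move=> w0 e0; apply: eq_to_path; first by rewrite w0.
by move=> r r01; rewrite e0.
Qed.

Lemma contr_eq_point w s t : loop_at w s = point ->
  (forall r, 0 <= r <= 1 -> loop_at (evl w) (s * (1 - r * Num.min t 1)) = point)
    ->
  contr w s t = point.
Proof.
rewrite /contr; case: (leP t 1) => t1 w0 e0; first by rewrite lag_eq_point.
by apply: cone_right_base; left; rewrite lag_eq_point// to_fibre_point.
Qed.

Lemma contr_apex w s t : 2 <= t -> contr w s t = point.
Proof.
move=> t2; rewrite /contr ifF; last by apply/negbTE; rewrite -ltNge; lra.
by apply: cone_right_base; right; lra.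
Qed.

(** At the end of the loop the point is the base point and only the image of the
    loop in [X] is left, so contractions of two loops with the same image can be
    joined. *)
Lemma contr_end w w' t : evl w = evl w' -> contr w 1 t = contr w' 1 t.
Proof. by move=> ew; rewrite /contr /lag ew !loop_at_ge1. Qed.

Lemma contr0 w s : contr w s 0 = cone_left (to_path (ev R X) (loop_at w s)
    (fun=> ev R X (loop_at w s))).
Proof.
rewrite /contr ler01; congr cone_left; apply: eq_to_path => // r r01.
rewrite to_path_at//; first by rewrite mulr0 subr0 mulr1.
by split=> //; exact: const_continuous.
Qed.

(** As [h] goes from 0 to 1, the parameters [sigma s h] and [tau s h] of [contr]
    move from [s] and 0 to a point of the polygonal line on which [tau = 2] and
    then [sigma = 1]. On that line [contr] depends only on the image of the loop
    in [X], so two contractions with these parameters can be glued at [h = 1].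
    The parameters stay fixed for [s = 1]; for [s = 0] they stay on the side
    [sigma = 0], where [contr] is the base point. *)
Definition sigma (s h : R) : R := (1 - h) * s + h * Num.min (2 * s) 1.
Definition tau (s h : R) : R := h * Num.min 2 (4 * (1 - s)).

(** A path in the mapping cone from the point [w s] to the point [[ev w, s]]. *)
Definition bridge (w : loop R SX) (s h : R) : M :=
  cat2 (fun h => contr w (sigma s h) (tau s h))
       (fun h => contr (susp_unit R (evl w)) (sigma s (1 - h)) (tau s (1 - h)))
         h.

(** The image of [bridge] in [X] is the image of [w], run through in this
    time. *)
Definition shadow (s h : R) : R :=
  let r h := sigma s h * (1 - Num.min (tau s h) 1) in cat2 r
    (fun h => r (1 - h)) h.

Lemma contr_meet w w' s : 0 <= s <= 1 -> evl w = evl w' ->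
  contr w (sigma s 1) (tau s 1) = contr w' (sigma s 1) (tau s 1).
Proof.
move=> s01 ew; have [s2|/ltW s2] := leP s 2^-1.
  rewrite !contr_apex// /tau; rewrite mul1r le_min lexx; lra.
have -> : sigma s 1 = 1 by rewrite /sigma; case: leP; lra.
exact: contr_end.
Qed.

Lemma bridge_continuous (V : topologicalType) (w : V -> loop R SX)
    (s h : V -> R) :
  k_space V -> continuous w -> continuous s -> continuous h ->
    (forall v, 0 <= s v <= 1) ->
  continuous (fun v => bridge (w v) (s v) (h v)).
Proof.
move=> kV cw cs ch s01; apply: cat2_continuous => // [||v].
- by apply: contr_continuous => //; rewrite /sigma /tau; continuity.
- apply: contr_continuous; rewrite // /sigma /tau; try by continuity.
  by apply: susp_unit_continuous => //; exact: loop_map_continuous_comp.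
- by rewrite subr0; apply: contr_meet => //; rewrite loop_map_ev_unit.
Qed.

Lemma ganea_cone_bridge w s h :
  ganea_cone R p1 (bridge w s h) = loop_at (evl w) (shadow s h).
Proof.
rewrite /bridge /shadow /cat2; case: ifP => _; rewrite ganea_cone_contr//.
by rewrite loop_map_ev_unit.
Qed.

Lemma shadow_continuous (V : topologicalType) (s h : V -> R) :
  continuous s -> continuous h -> continuous (fun v => shadow (s v) (h v)).
Proof.
move=> cs ch; rewrite /shadow; apply: cat2_continuous => // [||v].
- by rewrite /sigma /tau; continuity.
- by rewrite /sigma /tau; continuity.
- by rewrite subr0.
Qed.

(** The path coordinate straightens the time [shadow s h] to [s], so that the
    end of the path is the value prescribed by the canonical map. *)
Definition bridge_over (w : loop R SX) (s h : R) :
    path_space R (ganea_cone R p1) :=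
  to_path (ganea_cone R p1) (bridge w s h)
    (fun u => loop_at (evl w) ((1 - u) * shadow s h + u * s)).

Lemma bridge_over_continuous : continuous (fun p : (loop R SX * I) * I =>
  bridge_over p.1.1 (unit_val p.1.2) (unit_val p.2)).
Proof.
have kV : k_space ((loop R SX * I) * I)%type by do 2! apply: k_space_prodI;
  exact: k_space_loop.
apply: to_path_continuous => // [||p].
- apply: bridge_continuous => //; try by continuity.
  by move=> p; rewrite unit_val_ge0 unit_val_le1.
- apply: loop_at_continuous; first by apply: loop_map_continuous_comp;
  continuity.
  have cs : continuous (fun p : loop R SX * I * I * I => shadow
    (unit_val p.1.1.2) (unit_val p.1.2)).
    by apply: shadow_continuous; continuity.
  by continuity.
- by rewrite ganea_cone_bridge subr0 mul0r mul1r addr0.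
Qed.

Lemma is_path_bridge_over w s h :
  is_path (ganea_cone R p1) (bridge w s h) (fun u => loop_at (evl w)
    ((1 - u) * shadow s h + u * s)).
Proof.
split; last by rewrite ganea_cone_bridge subr0 mul0r mul1r addr0.
have cu : continuous (fun u : I => (1 - unit_val u) * shadow s h + unit_val
  u * s) by continuity.
by apply: loop_at_continuous => //; exact: const_continuous.
Qed.

Lemma path_fibration_bridge_over w s h :
  path_fibration R (ganea_cone R p1) (bridge_over w s h) = loop_at (evl w) s.
Proof.
rewrite -(ps_at1 _ (lexx 1)) to_path_at ?lexx ?ler01//;
  last exact: is_path_bridge_over.
by rewrite subrr mul0r mul1r add0r.
Qed.

Lemma bridge_over_eq w s h (y : path_space R (ganea_cone R p1)) :
  bridge w s h = ps_pt y ->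
  (forall u, 0 <= u <= 1 -> loop_at (evl w) ((1 - u) * shadow s h + u * s)
    = ps_at y u) ->
  bridge_over w s h = y.
Proof. by move=> e1 e2; apply: eq_to_path => //; rewrite e1. Qed.

Lemma bridge_eq_point w s h :
  (forall h, 0 <= h <= 1 -> contr w (sigma s h) (tau s h) = point) ->
  (forall h, 0 <= h <= 1 -> contr (susp_unit R (evl w)) (sigma s h) (tau s h)
    = point) ->
  0 <= h <= 1 -> bridge w s h = point.
Proof.
move=> e1 e2 h01; rewrite /bridge /cat2; case: ifPn; rewrite -?ltNge => h2.
  by rewrite e1//; lra.
by rewrite e2//; lra.
Qed.

Definition ps_const (A B : ptopologicalType) (f : ptmap A B) (a : A) :
    path_space R f :=
  to_path f a (fun=> f a).

Lemma ps_const_at (A B : ptopologicalType) (f : ptmap A B) (a : A) r :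
    ps_at (ps_const f a) r = f a.
Proof.
rewrite /ps_at /= /to_path_fun; case: ifP => //.
Qed.

Lemma ps_const_continuous (V : topologicalType) (A B : ptopologicalType)
    (f : ptmap A B) (a : V -> A) :
  k_space V -> continuous a -> continuous (fun v => ps_const f (a v)).
Proof.
move=> kV ca; apply: to_path_continuous => //.
apply: (comp_continuous (@ptmap_continuous _ _ f)
  (f := fun p : V * I => a p.1)).
by continuity.
Qed.

Lemma ps_const_point (A B : ptopologicalType) (f : ptmap A B) :
    ps_const f point = point.
Proof. by apply: eq_to_path => // r _; rewrite ptmap_point. Qed.

Definition include_base (q : SX) : path_space R (ganea_cone R p1) :=
  ps_const (ganea_cone R p1) (cone_left (ps_const (ev R X) q)).

Lemma include_base_continuous : continuous include_base.
Proof.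
have kS : k_space SX by apply: k_space_susp; exact: k_space_loop.
apply: ps_const_continuous => //.
apply: (comp_continuous cone_left_continuous (f := fun q => ps_const (ev R X)
  q)).
by apply: ps_const_continuous => // v; exact: cvg_id.
Qed.

Lemma include_base_point : include_base point = point.
Proof. by rewrite /include_base ps_const_point ps_const_point. Qed.

Definition include_base_map : ptmap SX (path_space R (ganea_cone R p1)) :=
  PtMap include_base_continuous include_base_point.

Lemma path_fibration_include_base q : path_fibration R (ganea_cone R p1)
    (include_base q) = ev R X q.
Proof.
rewrite -(ps_at1 _ (lexx 1)) ps_const_at ganea_cone_left.
by rewrite -(ps_at1 _ (lexx 1)) ps_const_at.
Qed.

(** The conditions of [realization1_lift] hold because [bridge_over] degenerates
    to constant paths at the ends of the loop, of the edge, and for the constant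
    loop. *)
Lemma realization_to_ganea : exists F : ptmap (realization R (Lambda R X) 1)
    (path_space R (ganea_cone R p1)),
  forall z, path_fibration R (ganea_cone R p1) (F z) = canonical_map
    R (Lambda R X) 1 z.
Proof.
have sg0 h : sigma 0 h = 0 by rewrite /sigma; case: leP; lra.
have sg1 h : sigma 1 h = 1 by rewrite /sigma; case: leP; lra.
have ta1 h : tau 1 h = 0 by rewrite /tau; case: leP; lra.
have sgh s : sigma s 0 = s by rewrite /sigma; lra.
have tah s : tau s 0 = 0 by rewrite /tau mul0r.
have c0 w h : contr w (sigma 0 h) (tau 0 h) = point.
  apply: contr_eq_point; first by rewrite sg0 loop_at_le0.
  by move=> r _; rewrite sg0 mul0r loop_at_le0.
have c1 w h : contr w (sigma 1 h) (tau 1 h) = point.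
  apply: contr_eq_point; first by rewrite sg1 loop_at_ge1.
  move=> r _; rewrite sg1 ta1 loop_at_ge1//; rewrite (min_idPl ler01); lra.
have cp s t : contr point s t = point.
  by apply: contr_eq_point => // r _; rewrite ptmap_point.
have sh0 h : shadow 0 h = 0 by rewrite /shadow /cat2; case: ifP;
  rewrite sg0 mul0r.
have sh1 h : shadow 1 h = 1.
  by rewrite /shadow /cat2; case: ifP; rewrite sg1 ta1;
    rewrite (min_idPl ler01); lra.
have shh0 s : shadow s 0 = s.
  rewrite /shadow cat20 sgh tah; rewrite (min_idPl ler01); lra.
have shh1 s : shadow s 1 = s.
  rewrite /shadow cat21 subrr sgh tah; rewrite (min_idPl ler01); lra.
have [||w t|w t|||F [Fv Fc]] := @realization1_lift R X _ include_base_map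
  bridge_over.
- exact: bridge_over_continuous.
- move=> w h h01; apply: bridge_over_eq; first by apply: bridge_eq_point.
  by move=> u _; rewrite sh0 loop_at_le0//; lra.
- move=> h01; apply: bridge_over_eq; first by apply: bridge_eq_point.
  by move=> u _; rewrite sh1 loop_at_ge1//; lra.
- move=> *; apply: bridge_over_eq.
    by apply: bridge_eq_point => // h' _; rewrite ?ptmap_point ?susp_unit_point.
  by move=> u _; rewrite ptmap_point.
- move=> w t t01; apply: bridge_over_eq => [|u _].
    by rewrite /bridge cat20 sgh tah contr0.
  rewrite shh0 ps_const_at ganea_cone_left -(ps_at1 _ (lexx 1)) ps_const_at.
  by rewrite (_ : _ + _ = t); last lra.
- move=> w t t01; apply: bridge_over_eq => [|u _].
    by rewrite /bridge cat21 subrr sgh tah contr0 susp_unit_at.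
  rewrite shh1 ps_const_at ganea_cone_left -(ps_at1 _ (lexx 1)) ps_const_at.
  by rewrite (_ : _ + _ = t) ?ev_susp_at//; last lra.
exists F; apply: realization1_ind => [q|w t h t01 h01].
  by rewrite Fv canonical_vert; exact: path_fibration_include_base.
by rewrite Fc// canonical_cell path_fibration_bridge_over loop_at_map.
Qed.

End to_ganea.

(** * Flattening a well-pointed space at its base point *)

Section well_pointed.
Variables (R : realType).
Notation I := (unit_interval R).

Definition id_map (X : ptopologicalType) : ptmap X X :=
  @PtMap X X idfun (fun x : X => @cvg_id _ (nbhs x)) erefl.

(** The homotopy extension property for the inclusion of [X] in the whiskered
    space [X * 0] together with [point * I] pushes the base point up the
    whisker. Here [k] is the end of this homotopy and [psi] the height reached
    on the whisker: a point of positive height has left [X]. *)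
Lemma well_pointed_flat (X : ptopologicalType) : well_pointed R X ->
  exists (k : ptmap X X) (psi : X -> R),
    [/\ homotopic R (id_map X) k, continuous psi, forall x, 0 <= psi x <= 1,
        psi point = 1 & forall x, 0 < psi x -> k x = point].
Proof.
move=> wX; pose A : set (X * I) := [set p | p.1 = point \/ p.2 = zero].
pose Y : topologicalType := set_type A.
have vY : continuous (set_val : Y -> X * I) by exact: initial_continuous.
have A0 x : (x, zero : I) \in A by rewrite inE; right.
have A1 t : (point : X, t) \in A by rewrite inE; left.
pose f (x : X) : Y := exist (fun p => p \in A) _ (A0 x).
pose w (t : I) : Y := exist (fun p => p \in A) _ (A1 t).
have cf : continuous f.
  apply: continuous_comp_initial.
  apply: (pair_continuous (f := fun x : X => x) (g := fun=> zero : I));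
    continuity.
have cw : continuous w.
  apply: continuous_comp_initial.
  apply: (pair_continuous (f := fun=> point : X) (g := fun t : I => t));
    continuity.
have [|H [cH H0 Hp]] := wX Y f w cf cw; first exact: val_inj.
pose K (p : X * I) : X := (set_val (H p)).1.
have cK : continuous K.
  apply: (comp_continuous (@fst_continuous _ _));
    exact: (comp_continuous vY cH).
have K0 x : K (x, zero) = x by rewrite /K H0.
have Kp t : K (point, t) = point by rewrite /K Hp.
have ck : continuous (fun x => K (x, one)).
  by apply: (comp_continuous cK (f := fun x => (x, one))); continuity.
exists (PtMap ck (Kp one)), (fun x => unit_val (set_val (H (x, one))).2).
split=> [|||| x psix].
- by exists K.
- have cH1 : continuous (fun x => (set_val (H (x, one))).2).
    apply: (comp_continuous (@snd_continuous _ _) (f := fun x => set_val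
      (H (x, one)))).
    apply: (comp_continuous vY (f := fun x => H (x, one))).
    by apply: (comp_continuous cH (f := fun x => (x, one))); continuity.
  exact: (comp_continuous (@unit_val_continuous R) cH1).
- by move=> x; rewrite unit_val_ge0 unit_val_le1.
- by rewrite Hp.
- have [//|z] := set_mem (valP (H (x, one))).
  by move: psix; rewrite (_ : (set_val _).2 = zero)// unit_val0 ltxx.
Qed.

(** By compactness of the interval, values near [v0] are uniformly close to
    those at [v0]. *)
Lemma inf_continuous (V : topologicalType) (F : V * I -> R) (m : R) :
  continuous F -> (forall p, m <= F p) ->
  continuous (fun v => inf [set F (v, t) | t in [set: I]]).
Proof.
move=> cF mF v0; apply/cvgrPdist_le => e e0.
have he : 0 < e / 2 by lra.
pose W : set (V * I) := [set p | `|F (v0, p.2) - F p| < e].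
have oW : open W.
  have cG : continuous (fun p : V * I => `|F (v0, p.2) - F p|).
    apply: (comp_continuous (@norm_continuous R R) (f := fun p : V * I => F
      (v0, p.2) - F p)).
    apply: realD_continuous; last exact: realN_continuous.
    by apply: (comp_continuous cF (f := fun p : V * I => (v0, p.2)));
      continuity.
  rewrite (_ : W = (fun p => `|F (v0, p.2) - F p|) @^-1` [set x | x < e]) //.
  by apply: open_comp => [p _|]; [exact: cG|exact: open_lt].
have hl v : has_inf [set F (v, t) | t in [set: I]].
  split; first by exists (F (v, zero)), zero.
  by exists m => _ [t _ <-]; exact: mF.
have ll v t : inf [set F (v, t) | t in [set: I]] <= F (v, t).
  by apply: (ge_inf (hl v).2); exists t.
have := tube_open (@unit_interval_compact R) oW.
rewrite openE => /(_ v0) oV; apply: filterS (oV _) => [v Wv|k _]; last first.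
  by rewrite /W /= subrr normr0.
have {}Wv t : `|F (v0, t) - F (v, t)| < e by exact: Wv.
rewrite ler_distlC; apply/andP; split.
- apply: lb_le_inf; first exact: (hl v).1.
  move=> _ [t _ <-]; have := ll v0 t; have := Wv t; rewrite ltr_norml; lra.
- rewrite -lerBlDr; apply: lb_le_inf; first exact: (hl v0).1.
  move=> _ [t _ <-]; have := ll v t; have := Wv t; rewrite ltr_norml; lra.
Qed.

(** The height of a loop is the smallest height of its points. *)
Lemma well_pointed_loop (X : ptopologicalType) : well_pointed R X ->
  exists (k : ptmap X X) (psi : loop R X -> R),
    [/\ homotopic R (id_map X) k, continuous psi, forall w, 0 <= psi w <= 1,
        psi point = 1 & forall w, 0 < psi w -> loop_map R k w = point].
Proof.
move=> /well_pointed_flat [k [psi [hk cpsi psi01 psip psik]]].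
pose F (p : loop R X * I) := psi (ev_fun p).
have cF : continuous F by apply: comp_continuous cpsi _; exact: ev_continuous.
exists k, (fun w => inf [set F (w, t) | t in [set: I]]).
have hl w : has_inf [set F (w, t) | t in [set: I]].
  split; first by exists (F (w, zero)), zero.
  by exists 0 => _ [t _ <-]; have /andP[] := psi01 (ev_fun (w, t)).
have ll w t : inf [set F (w, t) | t in [set: I]] <= F (w, t).
  by apply: (ge_inf (hl w).2); exists t.
split=> //.
- by apply: (inf_continuous (m := 0)) => // p; have /andP[] := psi01 (ev_fun p).
- move=> w; apply/andP; split.
    apply: lb_le_inf; first exact: (hl w).1.
    by move=> _ [t _ <-]; have /andP[] := psi01 (ev_fun (w, t)).
  by apply: le_trans (ll w zero) _; have /andP[] := psi01 (ev_fun (w, zero)).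
- rewrite (_ : [set F (point, t) | t in [set: I]] = [set 1]) ?inf1//.
  apply/seteqP; split=> [_ [t _ <-]|_ ->]; first exact: psip.
  by exists zero.
- move=> w w0; apply: eq_loop => r _; rewrite loop_at_map; apply: psik.
  exact: lt_le_trans w0 (ll w (clamp r)).
Qed.
End well_pointed.

(** * Words in loops and suspended loops *)

Section joint.
Variable R : realType.
Notation I := (unit_interval R).

(** Families of formulas over [V] with a real time. The time ranges over all
    reals, since a concatenation evaluates both of its pieces outside the unit
    interval. *)
Definition jointly_continuous (V Z : topologicalType) (F : V -> R -> Z) :=
  continuous (fun p : V * R => F p.1 p.2).

Lemma jointly_continuous_at (V W Z : topologicalType) (F : V -> R -> Z)
    (f : W -> V) (c : W -> R) :
  jointly_continuous F -> continuous f -> continuous c ->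
  continuous (fun w => F (f w) (c w)).
Proof.
by move=> jF cf cc; apply: (comp_continuous jF (f := fun w => (f w, c w)));
  exact: pair_continuous.
Qed.

Lemma cat2_jointly_continuous (V Z : topologicalType) (F G : V -> R -> Z) :
  jointly_continuous F -> jointly_continuous G -> (forall v, F v 1 = G v 0) ->
  jointly_continuous (fun v => cat2 (F v) (G v)).
Proof.
move=> jF jG FG; apply: (cat2_continuous (F := fun p : V * R => F p.1)
  (G := fun p => G p.1) (c := snd)) => [|||p].
- exact: snd_continuous.
- by apply: (jointly_continuous_at jF); continuity.
- by apply: (jointly_continuous_at jG); continuity.
- exact: FG.
Qed.

Lemma jointly_continuous_to_loop (V : topologicalType) (Y : ptopologicalType)
    (F : V -> R -> Y) :
  k_space V -> jointly_continuous F -> (forall v, F v 0 = point) ->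
  (forall v, F v 1 = point) -> continuous (fun v => to_loop (F v)).
Proof.
move=> kV jF F0 F1; apply: to_loop_continuous => //.
by apply: (jointly_continuous_at jF); continuity.
Qed.

Lemma loop_jointly_continuous (V : topologicalType) (Y : ptopologicalType)
    (w : V -> loop R Y) (c : V -> R -> R) :
  continuous w -> jointly_continuous c ->
    jointly_continuous (fun v r => loop_at (w v) (c v r)).
Proof.
move=> cw jc; apply: loop_at_continuous => //.
by apply: (comp_continuous cw); exact: fst_continuous.
Qed.

Lemma susp_jointly_continuous (V : topologicalType) (Y : ptopologicalType)
    (w : V -> Y) (c : V -> R -> R) :
  continuous w -> jointly_continuous c ->
    jointly_continuous (fun v r => susp_at (w v) (c v r)).
Proof.
move=> cw jc; apply: susp_at_continuous => //.
by apply: (comp_continuous cw); exact: fst_continuous.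
Qed.

Lemma is_loop_jointly_continuous (Y : ptopologicalType) (phi : R -> Y) :
  continuous phi -> phi 0 = point -> phi 1 = point -> is_loop phi.
Proof. by move=> cphi p0 p1; split=> //;
  exact: comp_continuous cphi (@unit_val_continuous R). Qed.
End joint.

Section words.
Variables (R : realType) (X : ptopologicalType).
Notation I := (unit_interval R).
Notation SX := (susp_loop R X).
Implicit Types (b : loop R X) (u : R -> X).

Definition chain b (sg : R) u : R -> X := cat2 (fun r => loop_at b (r * sg)) u.

(** From the suspension point [[b, sg]] back to time 0, then through the
    suspended loop of [b] up to [sg] followed by [u]. *)
Definition omega b (sg : R) u : R -> SX :=
  cat2 (fun r => susp_at b (sg * (1 - r)))
       (fun r => susp_at (to_loop (chain b sg u)) r).

(** The image of [omega] in [X] has this form: it moves along [b] and back at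
    times [p] and [q] before following [u]. *)
Definition spur b (p q : R -> R) u : R -> X :=
  cat2 (fun r => loop_at b (p r)) (cat2 (fun r => loop_at b (q r)) u).

Lemma omega0 b sg u : omega b sg u 0 = susp_at b sg.
Proof. by rewrite /omega cat20 subr0 mulr1. Qed.
Lemma omega1 b sg u : omega b sg u 1 = point.
Proof. by rewrite /omega cat21 susp_at_ge1. Qed.

Section continuity.
Variables (V : topologicalType) (b : V -> loop R X) (sg : V -> R)
  (u : V -> R -> X).
Hypotheses (kV : k_space V) (cb : continuous b) (csg : continuous sg).
Hypotheses (cu : jointly_continuous u) (u0 : forall v, u v 0 = loop_at (b v)
  (sg v)).
Hypothesis u1 : forall v, u v 1 = point.

Lemma chain_continuous : jointly_continuous (fun v => chain (b v) (sg v) (u v)).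
Proof.
apply: cat2_jointly_continuous => // [|v]; last by rewrite mul1r u0.
by apply: loop_jointly_continuous => //; rewrite /jointly_continuous;
  continuity.
Qed.

Lemma chain_loop_continuous :
    continuous (fun v => to_loop (chain (b v) (sg v) (u v))).
Proof.
apply: jointly_continuous_to_loop => // [|v|v]; first exact: chain_continuous.
- by rewrite /chain cat20 loop_at_le0// mul0r.
- by rewrite /chain cat21 u1.
Qed.

Lemma omega_continuous : jointly_continuous (fun v => omega (b v) (sg v) (u v)).
Proof.
apply: cat2_jointly_continuous => // [||v].
- by apply: susp_jointly_continuous => //; rewrite /jointly_continuous;
  continuity.
- apply: susp_jointly_continuous; first exact: chain_loop_continuous.
  by rewrite /jointly_continuous; continuity.
- by rewrite subrr mulr0 !susp_at_le0.
Qed.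

Lemma omega_loop_continuous : (forall v, sg v = 1) ->
  continuous (fun v => to_loop (omega (b v) (sg v) (u v))).
Proof.
move=> sg1; apply: jointly_continuous_to_loop => // [|v|v];
  first exact: omega_continuous.
- by rewrite omega0 sg1 susp_at_ge1.
- exact: omega1.
Qed.
End continuity.

Lemma spur_continuous (V : topologicalType) (b : V -> loop R X)
    (p q : V -> R -> R) (u : V -> R -> X) :
  continuous b -> jointly_continuous p -> jointly_continuous q ->
    jointly_continuous u ->
  (forall v, p v 1 = q v 0) -> (forall v, u v 0 = loop_at (b v) (q v 1)) ->
  jointly_continuous (fun v => spur (b v) (p v) (q v) (u v)).
Proof.
move=> cb cp cq cu pq u0; apply: cat2_jointly_continuous => [||v].
- exact: loop_jointly_continuous.
- apply: cat2_jointly_continuous; [exact: loop_jointly_continuous|exact: cu|].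
  by move=> v; rewrite u0.
- by rewrite cat20 pq.
Qed.

Lemma eq_spur b b' p p' q q' u u' t :
  (forall r, 0 <= r <= 1 -> loop_at b (p r) = loop_at b' (p' r)) ->
  (forall r, 0 <= r <= 1 -> loop_at b (q r) = loop_at b' (q' r)) ->
  (forall r, 0 <= r <= 1 -> u r = u' r) ->
  0 <= t <= 1 -> spur b p q u t = spur b' p' q' u' t.
Proof. by move=> e1 e2 e3; apply: eq_cat2 => //; apply: eq_cat2. Qed.

Section one_word.
Variables (b : loop R X) (sg : R) (u : R -> X).
Hypotheses (cu : continuous u) (u0 : u 0 = loop_at b sg) (u1 : u 1 = point).

Let juse (Z : topologicalType) (f : R -> Z) : continuous f ->
  jointly_continuous (fun _ : unit_interval R => f).
Proof. by move=> cf; apply: (comp_continuous cf); exact: snd_continuous. Qed.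

Let kI : k_space (unit_interval R).
Proof. exact: k_space_compact_hausdorff (unit_interval_compact_hausdorff R).
  Qed.

Lemma chain_at r : 0 <= r <= 1 -> loop_at (to_loop (chain b sg u))
    r = chain b sg u r.
Proof.
apply: loop_at_to_loop; apply: is_loop_jointly_continuous.
- have j := chain_continuous (V := I) (b := fun=> b) (sg := fun=> sg)
  (u := fun=> u) (@const_continuous _ _ b) (@const_continuous _ _ sg) (juse cu)
  (fun=> u0).
  by apply: (jointly_continuous_at j (f := fun=> zero)); continuity.
- by rewrite /chain cat20 loop_at_le0// mul0r.
- by rewrite /chain cat21 u1.
Qed.

Lemma ev_omega t : 0 <= t <= 1 ->
  ev R X (omega b sg u t) = spur b (fun r => sg * (1 - r)) (fun r => r * sg)
    u t.
Proof.
move=> t01; rewrite /omega /cat2; case: ifPn => t2.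
  by rewrite ev_susp_at /spur cat2_le.
rewrite ev_susp_at chain_at; last by move: t2; rewrite -ltNge; lra.
by rewrite /spur /cat2 (negbTE t2).
Qed.

Lemma omega_at r : sg = 1 -> 0 <= r <= 1 -> loop_at (to_loop (omega b sg u))
    r = omega b sg u r.
Proof.
move=> sg1; apply: loop_at_to_loop; apply: is_loop_jointly_continuous.
- have j := omega_continuous (V := I) (b := fun=> b) (sg := fun=> sg)
  (u := fun=> u) kI (@const_continuous _ _ b) (@const_continuous _ _ sg)
  (juse cu) (fun=> u0) (fun=> u1).
  by apply: (jointly_continuous_at j (f := fun=> zero)); continuity.
- by rewrite omega0 sg1 susp_at_ge1.
- exact: omega1.
Qed.

Lemma evl_omega : sg = 1 -> loop_map R (ev R X) (to_loop (omega b sg u)) =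
  to_loop (spur b (fun r => sg * (1 - r)) (fun r => r * sg) u).
Proof.
move=> sg1; apply/esym/to_loop_eq => r r01.
by rewrite loop_at_map omega_at// ev_omega.
Qed.
End one_word.

Lemma eq_omega b b' sg sg' u u' :
  (forall r, 0 <= r <= 1 -> susp_at b (sg * (1 - r)) = susp_at b'
    (sg' * (1 - r))) ->
  (forall r, 0 <= r <= 1 -> loop_at b (r * sg) = loop_at b' (r * sg')) ->
  (forall r, 0 <= r <= 1 -> u r = u' r) ->
  forall t, 0 <= t <= 1 -> omega b sg u t = omega b' sg' u' t.
Proof.
move=> e1 e2 e3 t t01; apply: eq_cat2 => // r _; congr (susp_at _ _).
by apply: eq_to_loop => r' r01; apply: eq_cat2.
Qed.

End words.

(** * Contracting the fibre inside the realization *)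

Section null.
Variables (R : realType) (X : ptopologicalType).
Notation I := (unit_interval R).
Notation SX := (susp_loop R X).
Notation G1 := (path_space R (ev R X)).
Notation L1 := (realization R (Lambda R X) 1).
Variables (k : ptmap X X) (psi : loop R X -> R).
Hypothesis cpsi : continuous psi.
Hypothesis psi01 : forall w, 0 <= psi w <= 1.
Hypothesis psi_point : psi point = 1.
Hypothesis psik : forall w, 0 < psi w -> loop_map R k w = point.

(** The path [y], moved by [k] and preceded by the stretch of [a] between the
    times [sg] and [s]. The contraction uses the time [sg] of a rescaled
    suspension coordinate, whereas [y] starts at [a s]. *)
Definition exit (a : loop R X) (s : R) (y : G1) (sg : R) : R -> X :=
  fun r => k (cat2 (fun r => loop_at a ((1 - r) * sg + r * s)) (ps_at y) r).

(** What remains of [exit] when the point [[a, s]] is the base point. *)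
Definition exit0 (y : G1) : R -> X :=
    cat2 (fun=> point) (fun r => k (ps_at y r)).

Notation kl := (loop_map R k).

(** Stage [x <= 1]: the suspension coordinate is [x]. Stage [1 <= x <= 2]: the
    coordinate has reached 1, [omega] is a loop, and the edges of this loop are
    crossed towards its image in [X]. *)
Definition fill1 a s y (x t : R) : L1 :=
  if x <= 1 then vert (omega (kl a) x (exit a s y x) t)
  else cell (to_loop (omega (kl a) 1 (exit a s y 1))) t (x - 1).

(** Read from [x = 2] down to 0, this continues [fill1]: the image of the loop
    is deformed by withdrawing the detour along [a], then the edges of the loop
    found for constant [a] are crossed in the opposite direction. *)
Definition fill2 a s y (x t : R) : L1 :=
  if x <= 1 then cell (to_loop (omega point 1 (exit a s y 1))) t x
  else vert (susp_at (to_loop (spur (kl a) (fun r => 1 - (x - 1) * r)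
     (fun r => 1 - (x - 1) * (1 - r)) (exit a s y 1))) t).

(** The suspension coordinate is stretched by 4: the first quarter carries
    [omega], the rest the correction. The cut at [3 - 2 psi] and [2 - 2 psi]
    stops the correction at the same height of the edges in both directions; for
    [psi = 1] no edge is crossed and for [psi = 0] nothing is cut. *)
Definition fill a s y (t : R) : L1 :=
  if 4 * s <= 2 then fill1 a s y (Num.min (4 * s) (3 - 2 * psi a)) t
  else fill2 a s y (Num.min (4 - 4 * s) (2 - 2 * psi a)) t.

(** The common value of [fill] over the points where [[a, s]] is the base
    point. *)
Definition fill0 y (t : R) : L1 := vert (omega point 0 (exit0 y) t).

Lemma exit_start a s y sg : exit a s y sg 0 = loop_at (kl a) sg.
Proof. by rewrite /exit cat20 loop_at_map subr0 mul1r mul0r addr0. Qed.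
Lemma exit_end a s y sg : exit a s y sg 1 = k (ps_at y 1).
Proof. by rewrite /exit cat21. Qed.

Lemma exit_base a s y sg r : kl a = point \/ (s = 0 /\ sg = 0)
    \/ (s = 1 /\ sg = 1) ->
  exit a s y sg r = exit0 y r.
Proof.
move=> e; rewrite /exit /exit0 /cat2; case: ifP => // _.
case: e => [e|[[-> ->]|[-> ->]]].
- by rewrite -loop_at_map e.
- by rewrite loop_at_le0 ?ptmap_point//; lra.
- by rewrite loop_at_ge1 ?ptmap_point//; lra.
Qed.

Section continuity.
Variables (V : topologicalType) (a : V -> loop R X) (s : V -> R) (y : V -> G1).
Hypotheses (kV : k_space V) (ca : continuous a) (cs : continuous s)
  (cy : continuous y).
Hypothesis ay : forall v, ps_at (y v) 0 = loop_at (a v) (s v).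

Lemma ps_jointly_continuous : jointly_continuous (fun v => ps_at (y v)).
Proof. by apply: ps_at_continuous; continuity. Qed.

Lemma exit_continuous (sg : V -> R) : continuous sg ->
  jointly_continuous (fun v => exit (a v) (s v) (y v) (sg v)).
Proof.
move=> csg; apply: (comp_continuous (@ptmap_continuous _ _ k)
  (f := fun p : V * R => cat2 (fun r => loop_at (a p.1)
    ((1 - r) * sg p.1 + r * s p.1)) (ps_at (y p.1)) p.2)).
apply: (cat2_jointly_continuous (F := fun v r => loop_at (a v)
  ((1 - r) * sg v + r * s v)) (G := fun v => ps_at (y v))) => [||v].
- by apply: loop_jointly_continuous => //; rewrite /jointly_continuous;
  continuity.
- exact: ps_jointly_continuous.
- by rewrite subrr mul0r mul1r add0r.
Qed.

Lemma kl_continuous : continuous (fun v => kl (a v)).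
Proof. exact: loop_map_continuous_comp. Qed.

Hypothesis y1 : forall v, ps_at (y v) 1 = point.

Let ex1 sg v : exit (a v) (s v) (y v) sg 1 = point.
Proof. by rewrite exit_end y1 ptmap_point. Qed.

Let cex (sg : R) v : continuous (exit (a v) (s v) (y v) sg).
Proof.
have j := @exit_continuous (fun=> sg) (@const_continuous _ _ sg).
by apply: (jointly_continuous_at j (f := fun=> v)); continuity.
Qed.

Lemma fill1_continuous (x t : V -> R) : continuous x -> continuous t ->
  (forall v, 0 <= t v <= 1) ->
  continuous (fun v => fill1 (a v) (s v) (y v) (x v) (t v)).
Proof.
move=> cx ct t01; apply: paste_continuous => // [||v xv].
- apply: (comp_continuous (@vert_continuous R X) (f := fun v => omega (kl (a v))
  (x v) (exit (a v) (s v) (y v) (x v)) (t v))).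
  have j := omega_continuous kV kl_continuous cx (exit_continuous cx)
    (fun v => exit_start _ _ _ _) (fun v => ex1 (x v) v).
  by apply: (jointly_continuous_at j (f := fun v => v)); continuity.
- have c1 : continuous (fun _ : V => 1 : R) by continuity.
  apply: cell_continuous => //; last by continuity.
  exact: (omega_loop_continuous kV kl_continuous c1 (exit_continuous c1)
    (fun v => exit_start _ _ _ _) (ex1 1)).
- by rewrite xv subrr cell_h0 omega_at// exit_start.
Qed.

Lemma fill2_continuous (x t : V -> R) : continuous x -> continuous t ->
  (forall v, 0 <= t v <= 1) ->
  continuous (fun v => fill2 (a v) (s v) (y v) (x v) (t v)).
Proof.
move=> cx ct t01.
have c1 : continuous (fun _ : V => 1 : R) by continuity.
have cp : continuous (fun _ : V => point : loop R X) by continuity.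
have e1 v : exit (a v) (s v) (y v) 1 0 = point by rewrite exit_start
  loop_at_ge1.
have j1 := exit_continuous c1.
apply: paste_continuous => // [||v xv].
- apply: cell_continuous => //.
  exact: (omega_loop_continuous kV cp c1 j1 e1 (ex1 1)).
- apply: (comp_continuous (@vert_continuous R X) (f := fun v => susp_at
  (to_loop (spur (kl (a v)) (fun r => 1 - (x v - 1) * r)
     (fun r => 1 - (x v - 1) * (1 - r)) (exit (a v) (s v) (y v) 1))) (t v))).
  apply: susp_at_continuous => //;
    apply: jointly_continuous_to_loop => // [|v|v].
  + apply: spur_continuous; last 3 first.
    * exact: j1.
    * by move=> v; rewrite subr0 mulr1.
    * by move=> v; rewrite e1 loop_at_ge1// subrr mulr0 subr0.
    * exact: kl_continuous.
    * by rewrite /jointly_continuous; continuity.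
    * by rewrite /jointly_continuous; continuity.
  + by rewrite /spur cat20 mulr0 subr0 loop_at_ge1.
  + by rewrite /spur !cat21.
- rewrite xv cell_h1; congr (vert (susp_at _ _)).
  by rewrite evl_omega// subrr; apply: eq_to_loop => r r01;
    apply: eq_spur => // r' _;
    rewrite [RHS]loop_at_ge1// mul0r subr0.
Qed.
End continuity.

Definition loop0 y : loop R SX := to_loop (omega point 1 (exit0 y)).

Section cell_values.
Variables (a : loop R X) (s : R) (y : G1).
Hypotheses (ay : ps_at y 0 = loop_at a s) (y1 : ps_at y 1 = point).

Lemma exit_cts sg : continuous (exit a s y sg).
Proof.
have kI := k_space_compact_hausdorff (unit_interval_compact_hausdorff R).
have j := @exit_continuous I (fun=> a) (fun=> s) (fun=> y)
  (@const_continuous _ _ a) (@const_continuous _ _ s) (@const_continuous _ _ y)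
  (fun=> ay) (fun=> sg) (@const_continuous _ _ sg).
by apply: (jointly_continuous_at j (f := fun=> zero)); continuity.
Qed.

Lemma exit_last sg : exit a s y sg 1 = point.
Proof. by rewrite exit_end y1 ptmap_point. Qed.

Lemma eq_fill_loop : kl a = point -> to_loop (omega (kl a) 1 (exit a s y 1))
    = loop0 y.
Proof.
move=> e; apply: eq_to_loop; apply: eq_omega => // r _.
- by rewrite e.
- by rewrite e.
- by apply: exit_base; left.
Qed.

End cell_values.

Section constant_values.
Variable y : G1.
Hypotheses (y0 : k (ps_at y 0) = point) (y1 : ps_at y 1 = point).

Lemma exit0_cts : continuous (exit0 y).
Proof.
apply: (cat2_continuous (F := fun _ : R => fun=> point)
  (G := fun _ : R => fun r => k (ps_at y r)) (c := fun r => r)) => [|||_];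
  last by rewrite y0.
- continuity.
- continuity.
- change (continuous (k \o (fun r => ps_at y (2 * r - 1)))).
  apply: comp_continuous; first exact: ptmap_continuous.
  by apply: (ps_at_continuous (y := fun=> y)); continuity.
Qed.

Lemma exit0_start (b : loop R X) sg : sg <= 0 \/ 1 <= sg ->
    exit0 y 0 = loop_at b sg.
Proof. by rewrite /exit0 cat20 => -[?|?];
  [rewrite loop_at_le0|rewrite loop_at_ge1]. Qed.

Lemma exit0_last : exit0 y 1 = point.
Proof. by rewrite /exit0 cat21 y1 ptmap_point. Qed.

Lemma loop0_at t : 0 <= t <= 1 -> loop_at (loop0 y) t = omega point 0 (exit0 y)
    t.
Proof.
move=> t01; rewrite omega_at ?exit0_last//;
  [|exact: exit0_cts|exact: (exit0_start _ (or_intror (lexx 1)))].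
by apply: eq_omega => // r _; rewrite !susp_at_point.
Qed.

Lemma cell_loop0 t : 0 <= t <= 1 -> cell (loop0 y) t 0 = fill0 y t.
Proof. by move=> t01; rewrite cell_h0 loop0_at. Qed.

(** If [k] kills [a], both halves of the correction run through the edges of the
    loop [loop0 y] only. This is what allows cutting them at equal heights. *)
Lemma fill1_trivial a s x t : kl a = point -> 0 <= t <= 1 ->
  fill1 a s y x t = cell (loop0 y) t (Num.max 0 (x - 1)).
Proof.
move=> e t01; rewrite /fill1; case: ifPn => x1; rewrite -?ltNge in x1.
  rewrite (max_idPl _); last lra.
  rewrite cell_loop0//; congr vert; apply: eq_omega => // r _.
  - by rewrite e !susp_at_point.
  - by rewrite e.
  - by apply: exit_base; left.
by rewrite (max_idPr _) ?eq_fill_loop//; lra.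
Qed.

Lemma fill2_trivial a s x t : kl a = point -> 0 <= t <= 1 ->
  fill2 a s y x t = cell (loop0 y) t (Num.min x 1).
Proof.
move=> e t01.
have eE r : exit a s y 1 r = exit0 y r by apply: exit_base; left.
rewrite /fill2; case: ifPn => x1; rewrite -?ltNge in x1.
  rewrite (min_idPl x1); congr (cell _ _ _); apply: eq_to_loop.
  by apply: eq_omega => // r _; rewrite eE.
rewrite (min_idPr (ltW x1)) cell_h1 evl_omega ?exit0_last//; last 2 first.
- exact: exit0_cts.
- exact: (exit0_start _ (or_intror (lexx 1))).
congr (vert (susp_at _ _)); apply: eq_to_loop => r r01;
  apply: eq_spur => // r' _; by rewrite ?e ?eE.
Qed.
End constant_values.

Section values.
Variables (a : loop R X) (s : R) (y : G1).
Hypotheses (ay : ps_at y 0 = loop_at a s) (y1 : ps_at y 1 = point).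

(** At the middle, either [psi] vanishes and both halves arrive at the suspended
    image of the loop, or [k] kills [a] and both halves stop at the same height
    of the same edge. *)
Lemma fill_meet t : 4 * s = 2 -> 0 <= t <= 1 ->
  fill1 a s y (Num.min (4 * s) (3 - 2 * psi a)) t =
  fill2 a s y (Num.min (4 - 4 * s) (2 - 2 * psi a)) t.
Proof.
move=> s2 t01; have /andP[p0 p1] := psi01 a.
have [pa|pa] := eqVneq (psi a) 0; last first.
  have e : kl a = point by apply: psik; rewrite lt_neqAle eq_sym pa.
  have y0 : k (ps_at y 0) = point by rewrite ay -loop_at_map e.
  rewrite fill1_trivial// fill2_trivial//; congr (cell _ _ _).
  rewrite s2; have -> : 4 - 2 = 2 :> R by lra.
  case: (leP 2 (3 - 2 * psi a)) => h1; case: (leP 2 (2 - 2 * psi a)) => h2;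
  rewrite /Order.max /Order.min;
    repeat (case: ifPn; rewrite -?leNgt -?ltNge => ?); lra.
rewrite pa s2 mulr0 !subr0; have -> : 4 - 2 = 2 :> R by lra.
rewrite (min_idPl _) ?(min_idPl _) ?lexx//; last lra.
rewrite /fill1 /fill2 !ifF; try by apply/negbTE; rewrite -ltNge; lra.
have -> : 2 - 1 = 1 :> R by lra.
rewrite cell_h1 evl_omega ?exit_start ?exit_last//; last exact: exit_cts.
congr (vert (susp_at _ _)); apply: eq_to_loop => r r01;
  apply: eq_spur => // r' _;
  congr (loop_at _ _); lra.
Qed.

Lemma fill_start : fill a s y 0 = vert (susp_at (kl a) (4 * s)).
Proof.
have /andP[p0 p1] := psi01 a.
have f1 x : fill1 a s y x 0 = vert (susp_at (kl a) x).
  rewrite /fill1; case: ifPn => x1; first by rewrite omega0.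
  rewrite cell_base; last exact: susp_at_le0.
  by rewrite susp_at_ge1 ?vert_point//; move: x1; rewrite -ltNge => /ltW.
rewrite /fill; case: ifPn => s2.
  rewrite f1; case: leP => // h; rewrite !susp_at_ge1//; lra.
rewrite [in RHS]susp_at_ge1; last by move: s2; rewrite -ltNge; lra.
rewrite vert_point /fill2; case: ifP => _;
  first by rewrite cell_base ?susp_at_le0.
by rewrite susp_at_le0 ?vert_point.
Qed.

Lemma fill_end : fill a s y 1 = point.
Proof.
rewrite /fill /fill1 /fill2; do 2 case: ifP => _.
- by rewrite omega1 vert_point.
- by rewrite cell_base ?susp_at_ge1.
- by rewrite cell_base ?susp_at_ge1.
- by rewrite susp_at_ge1 ?vert_point.
Qed.

(** This makes [fill] a function of the point [[a, s]] of the reduced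
    suspension. The case of constant [a] is the one that needs the cut by
    [psi]. *)
Lemma fill_base t : 0 <= s <= 1 -> 0 <= t <= 1 ->
    [\/ a = point, s = 0 | s = 1] ->
  fill a s y t = fill0 y t.
Proof.
move=> s01 t01 base.
have y0 : k (ps_at y 0) = point.
  by rewrite ay; case: base => ->;
    [|rewrite loop_at_le0//|rewrite loop_at_ge1//]; exact: ptmap_point.
have /andP[p0 p1] := psi01 a.
rewrite -cell_loop0//; case: base => e.
- have ek : kl a = point by rewrite e ptmap_point.
  have pa : psi a = 1 by rewrite e.
  rewrite /fill pa; case: ifPn => s2; rewrite -?ltNge in s2.
    rewrite fill1_trivial//; congr (cell _ _ _); apply/max_idPl.
    by case: (leP (4 * s)) => ?; lra.
  rewrite fill2_trivial//; congr (cell _ _ _).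
  have -> : 2 - 2 * 1 = 0 :> R by lra.
  have -> : Num.min (4 - 4 * s) 0 = 0 by apply/min_idPr; lra.
  exact/min_idPl/ler01.
- rewrite /fill e mulr0 ler0n (min_idPl _); last lra.
  rewrite /fill1 ler01 cell_loop0//; congr vert; apply: eq_omega => // r _.
  + by rewrite mul0r susp_at_point susp_at_le0.
  + by rewrite mulr0 loop_at_point loop_at_le0.
  + by apply: exit_base; right; left.
- rewrite /fill e ifF; last by apply/negbTE; rewrite -ltNge; lra.
  have -> : 4 - 4 * 1 = 0 :> R by lra.
  rewrite (min_idPl _); last lra.
  rewrite /fill2 ler01; congr (cell _ _ _); apply: eq_to_loop;
    apply: eq_omega => // r _.
  by apply: exit_base; right; right.
Qed.
End values.

End null.

(** * The image of the contraction in X *)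

Section sweep.
Variables (R : realType) (X : ptopologicalType).
Notation I := (unit_interval R).
Notation SX := (susp_loop R X).
Notation G1 := (path_space R (ev R X)).
Notation L1 := (realization R (Lambda R X) 1).
Variables (k : ptmap X X) (psi : loop R X -> R).
Hypothesis cpsi : continuous psi.
Hypothesis psi01 : forall w, 0 <= psi w <= 1.
Hypothesis psi_point : psi point = 1.
Hypothesis psik : forall w, 0 < psi w -> loop_map R k w = point.
Notation kl := (loop_map R k).
Notation exit := (exit k).
Notation exit0 := (exit0 k).
Notation fill := (fill k psi).
Notation fill0 := (fill0 k).

(** The image of [fill] in [X] for [z = 0]; as [z] goes to 1, the detours along
    [a] are withdrawn to the starting point. *)
Definition track (a : loop R X) (s : R) (y : G1) (t z : R) : X :=
  if 4 * s <= 2 then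
    let sg := Num.min (4 * s) 1 in
    spur (kl a) (fun r => (1 - z) * (sg * (1 - r)) + z * sg)
      (fun r => (1 - z) * (r * sg) + z * sg) (exit a s y sg) t
  else
    let c := Num.max 0 (Num.min (4 - 4 * s) (2 - 2 * psi a) - 1) in
    spur (kl a) (fun r => 1 - (1 - z) * (c * r))
      (fun r => 1 - (1 - z) * (c * (1 - r))) (exit a s y 1) t.

(** First withdraw the detours, then move the starting point along the path to
    its end. *)
Definition sweep (a : loop R X) (s : R) (y : G1) (t : R) : R -> X :=
  cat2 (track a s y t) (fun z => exit a s y (Num.min (4 * s) 1)
    (Num.max z (4 * t - 3))).

Definition sweep0 (y : G1) (t : R) : R -> X :=
  cat2 (fun=> spur point id id (exit0 y) t)
    (fun z => exit0 y (Num.max z (4 * t - 3))).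

(** The trace of [sweep] at the starting point of the contraction. It is defined
    for any path [y] from [a s], not only for those ending at the base point. *)
Definition slide (a : loop R X) (s : R) (y : G1) : R -> X :=
  cat2 (fun=> loop_at (kl a) (4 * s)) (exit a s y (Num.min (4 * s) 1)).

Definition slide0 (y : G1) : R -> X := cat2 (fun=> point) (exit0 y).

Section continuity.
Variables (V : topologicalType) (a : V -> loop R X) (s t z : V -> R)
  (y : V -> G1).
Hypotheses (kV : k_space V) (ca : continuous a) (cs : continuous s)
  (ct : continuous t).
Hypotheses (cz : continuous z) (cy : continuous y).
Hypothesis ay : forall v, ps_at (y v) 0 = loop_at (a v) (s v).

Let cmin : continuous (fun v => Num.min (4 * s v) 1).
Proof. by continuity. Qed.

Lemma slide_continuous : continuous (fun v => slide (a v) (s v) (y v) (z v)).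
Proof.
apply: cat2_continuous => // [||v].
- by apply: loop_at_continuous; [exact: kl_continuous|continuity].
- have j := exit_continuous (k := k) ca cs cy ay cmin.
  by apply: (jointly_continuous_at j (f := fun v => v)); continuity.
- rewrite exit_start; case: (leP (4 * s v) 1) => // h.
  by rewrite !loop_at_ge1//; exact: ltW.
Qed.

Hypothesis y1 : forall v, ps_at (y v) 1 = point.
Hypothesis s01 : forall v, 0 <= s v <= 1.
Hypothesis t01 : forall v, 0 <= t v <= 1.

Lemma fill_continuous : continuous (fun v => fill (a v) (s v) (y v) (t v)).
Proof.
have cpa : continuous (fun v => psi (a v)) by apply: comp_continuous cpsi ca.
apply: paste_continuous => [|||v sv].
- by continuity.
- by apply: fill1_continuous => //; continuity.
- by apply: fill2_continuous => //; continuity.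
- exact: fill_meet.
Qed.

Lemma track_meet v : 4 * s v = 2 -> 0 <= t v <= 1 ->
    let sg := Num.min (4 * s v) 1 in
    let c := Num.max 0 (Num.min (4 - 4 * s v) (2 - 2 * psi (a v)) - 1) in
    spur (kl (a v)) (fun r => (1 - z v) * (sg * (1 - r)) + z v * sg)
      (fun r => (1 - z v) * (r * sg) + z v * sg) (exit (a v) (s v) (y v) sg)
        (t v) =
    spur (kl (a v)) (fun r => 1 - (1 - z v) * (c * r))
      (fun r => 1 - (1 - z v) * (c * (1 - r))) (exit (a v) (s v) (y v) 1) (t v).
Proof.
move=> s2 tv; cbv zeta; have -> : Num.min (4 * s v) 1 = 1 by apply/min_idPr;
  lra.
have [pa|pa] := eqVneq (psi (a v)) 0; last first.
  have /andP[p0 _] := psi01 (a v).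
  have e : kl (a v) = point by apply: psik; rewrite lt_neqAle eq_sym pa.
  by apply: eq_spur => // r _; rewrite e.
rewrite pa s2; have -> : Num.max 0 (Num.min (4 - 2) (2 - 2 * 0) - 1) = 1 :> R.
  by rewrite (min_idPl _) ?(max_idPr _); lra.
by apply: eq_spur => // r _; congr (loop_at _ _); ring.
Qed.

Lemma track_continuous : continuous (fun v => track (a v) (s v) (y v) (t v)
    (z v)).
Proof.
have cpa : continuous (fun v => psi (a v)) by apply: comp_continuous cpsi ca.
have c1 : continuous (fun _ : V => 1 : R) by continuity.
have j1 := exit_continuous (k := k) ca cs cy ay c1.
have j2 := exit_continuous (k := k) ca cs cy ay cmin.
have ckl : continuous (fun v => kl (a v)) by exact: kl_continuous.
apply: paste_continuous => [|||v sv].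
- by continuity.
- apply: (jointly_continuous_at (F := fun v => spur (kl (a v))
  (fun r => (1 - z v) * (Num.min (4 * s v) 1 * (1 - r)) + z v * Num.min (4 * s
  v) 1)
      (fun r => (1 - z v) * (r * Num.min (4 * s v) 1) + z v * Num.min (4 * s v)
        1) (exit (a v) (s v) (y v) (Num.min (4 * s v) 1))) (f := fun v => v))
        => //.
    apply: spur_continuous => // [|||v].
    + by rewrite /jointly_continuous; continuity.
    + by rewrite /jointly_continuous; continuity.
    + by move=> v /=; rewrite subrr mulr0 mul0r.
    + by rewrite exit_start; congr (loop_at _ _); ring.
  by continuity.
- apply: (jointly_continuous_at (F := fun v => spur (kl (a v))
  (fun r => 1 - (1 - z v) * (Num.max 0 (Num.min (4 - 4 * s v)
  (2 - 2 * psi (a v)) - 1) * r))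
      (fun r => 1 - (1 - z v) * (Num.max 0 (Num.min (4 - 4 * s v)
        (2 - 2 * psi (a v)) - 1) * (1 - r))) (exit (a v) (s v) (y v) 1))
        (f := fun v => v)) => //.
    apply: spur_continuous => // [|||v].
    + by rewrite /jointly_continuous; continuity.
    + by rewrite /jointly_continuous; continuity.
    + by move=> v /=; rewrite subr0 mulr1.
    + by rewrite exit_start; congr (loop_at _ _); ring.
  by continuity.
- exact: track_meet.
Qed.

Lemma track_last v : 0 <= t v <= 1 ->
  track (a v) (s v) (y v) (t v) 1 = exit (a v) (s v) (y v) (Num.min (4 * s v) 1)
    (Num.max 0 (4 * t v - 3)).
Proof.
move=> tv; have tE sg p q : (forall r, p r = sg) -> (forall r, q r = sg) ->
    spur (kl (a v)) p q (exit (a v) (s v) (y v) sg) (t v) = exit (a v) (s v)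
      (y v) sg (Num.max 0 (4 * t v - 3)).
  move=> ep eq; rewrite /spur /cat2 ep eq; case: ifPn => t2;
    rewrite -?ltNge in t2.
    by rewrite (max_idPl _) ?exit_start//; lra.
  case: ifPn => t3; rewrite -?ltNge in t3.
    by rewrite (max_idPl _) ?exit_start//; lra.
  by rewrite (max_idPr _); [congr (exit _ _ _ _ _); lra|lra].
rewrite /track; case: ifPn => s2; rewrite -?ltNge in s2.
  by apply: tE => r; rewrite subrr mul0r mul1r add0r.
rewrite (_ : Num.min (4 * s v) 1 = 1); last by apply/min_idPr; lra.
by apply: tE => r; rewrite subrr mul0r subr0.
Qed.
End continuity.

Lemma sweep_continuous (V : topologicalType) (a : V -> loop R X)
    (s t z : V -> R) (y : V -> G1) :
  k_space V -> continuous a -> continuous s -> continuous t -> continuous z ->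
    continuous y ->
  (forall v, ps_at (y v) 0 = loop_at (a v) (s v)) ->
  (forall v, 0 <= t v <= 1) ->
  continuous (fun v => sweep (a v) (s v) (y v) (t v) (z v)).
Proof.
move=> kV ca cs ct cz cy ay t01; apply: cat2_continuous => // [||v].
- by apply: track_continuous => //; continuity.
- have cmin : continuous (fun v => Num.min (4 * s v) 1) by continuity.
  have j := exit_continuous (k := k) ca cs cy ay cmin.
  by apply: (jointly_continuous_at j (f := fun v => v)); continuity.
- exact: track_last.
Qed.

Section values.
Variables (a : loop R X) (s : R) (y : G1).
Hypotheses (ay : ps_at y 0 = loop_at a s) (s01 : 0 <= s <= 1).

Lemma slide_first : slide a s y 0 = loop_at (kl a) (4 * s).
Proof. by rewrite /slide cat20. Qed.

Lemma slide_last : slide a s y 1 = k (ps_at y 1).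
Proof. by rewrite /slide cat21 exit_end. Qed.

Lemma base_exit r : [\/ a = point, s = 0 | s = 1] ->
  exit a s y (Num.min (4 * s) 1) r = exit0 y r.
Proof.
move=> base; apply: exit_base; case: base => [->|->|->].
- by left; rewrite ptmap_point.
- by right; left; split=> //; rewrite mulr0; apply/min_idPl.
- by right; right; split=> //; apply/min_idPr; lra.
Qed.

Lemma slide_base r : [\/ a = point, s = 0 | s = 1] ->
    slide a s y r = slide0 y r.
Proof.
move=> base; rewrite /slide /slide0 /cat2; case: ifP => _;
  last exact: base_exit.
case: base => ->; [by rewrite ptmap_point|by rewrite loop_at_le0//;
  lra|by rewrite loop_at_ge1//; lra].
Qed.

Hypothesis y1 : ps_at y 1 = point.

Lemma canonical_fill t : 0 <= t <= 1 ->
  canonical_map R (Lambda R X) 1 (fill a s y t) = sweep a s y t 0.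
Proof.
move=> t01; have /andP[p0 p1] := psi01 a.
have ex sg := exit_cts (k := k) ay sg.
have el sg : exit a s y sg 1 = point by exact: exit_last.
rewrite /sweep cat20 /track /fill; case: ifPn => s2; rewrite -?ltNge in s2.
  set x := Num.min (4 * s) (3 - 2 * psi a).
  have -> : Num.min (4 * s) 1 = Num.min x 1.
    by rewrite /x; case: (leP (4 * s) (3 - 2 * psi a)) => // h;
      rewrite !(min_idPr _)//; lra.
  rewrite /fill1; case: ifPn => x1; rewrite -?ltNge in x1.
    rewrite canonical_vert (min_idPl x1) ev_omega ?exit_start//; last exact: ex.
    by apply: eq_spur => // r _; congr (loop_at _ _); ring.
  rewrite canonical_cell (min_idPr (ltW x1)) omega_at ?exit_start//;
    last exact: ex.
  rewrite ev_omega ?exit_start//; last exact: ex.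
  by apply: eq_spur => // r _; congr (loop_at _ _); ring.
set x := Num.min (4 - 4 * s) (2 - 2 * psi a).
rewrite /fill2; case: ifPn => x1; rewrite -?ltNge in x1.
  rewrite (max_idPl _); last lra.
  have e0 : exit a s y 1 0 = loop_at (point : loop R X) 1 by rewrite exit_start
    loop_at_ge1.
  rewrite canonical_cell omega_at//; last exact: ex.
  rewrite ev_omega//; last exact: ex.
  by apply: eq_spur => // r _; rewrite [RHS]loop_at_ge1//; lra.
rewrite (max_idPr _); last lra.
rewrite canonical_vert ev_susp_at loop_at_to_loop//; last first.
  apply: is_loop_jointly_continuous; last 2 first.
  - by rewrite /spur cat20 mulr0 subr0 loop_at_ge1.
  - by rewrite /spur !cat21.
  have kI := k_space_compact_hausdorff (unit_interval_compact_hausdorff R).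
  have j := @spur_continuous R X I (fun=> kl a) (fun _ r => 1 - (x - 1) * r)
    (fun _ r => 1 - (x - 1) * (1 - r)) (fun=> exit a s y 1).
  have {}j := j (@const_continuous _ _ (kl a)).
  apply: (jointly_continuous_at (j _ _ _ _ _) (f := fun=> zero));
    try by continuity.
  + by rewrite /jointly_continuous; continuity.
  + by rewrite /jointly_continuous; continuity.
  + by apply: (comp_continuous (ex 1)); exact: snd_continuous.
  + by move=> _ /=; rewrite subr0 mulr1.
  + by move=> _ /=; rewrite exit_start; congr (loop_at _ _); ring.
by apply: eq_spur => // r _; congr (loop_at _ _); ring.
Qed.

Lemma sweep_start z : 0 <= z <= 1 -> sweep a s y 0 z = slide a s y z.
Proof.
move=> z01; apply: eq_cat2 => // r r01; last by congr (exit _ _ _ _ _);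
  apply/max_idPl; lra.
rewrite /track; case: ifPn => s2; rewrite -?ltNge in s2.
  rewrite /spur cat20; case: (leP (4 * s) 1) => h; first by congr (loop_at _ _);
    ring.
  by rewrite !loop_at_ge1//; lra.
by rewrite /spur cat20 !loop_at_ge1//; lra.
Qed.

Lemma sweep_end z : 0 <= z <= 1 -> sweep a s y 1 z = point.
Proof.
move=> z01; have el sg : exit a s y sg 1 = point by exact: exit_last.
rewrite /sweep /cat2; case: ifPn => z2; rewrite -?ltNge in z2.
  by rewrite /track; case: ifP => _; rewrite /spur !cat21.
have -> : Num.max (2 * z - 1) (4 * 1 - 3) = 1 by rewrite (max_idPr _); lra.
exact: el.
Qed.

Lemma sweep_last t : 0 <= t <= 1 -> sweep a s y t 1 = point.
Proof.
by move=> t01; rewrite /sweep cat21 (max_idPl _) ?exit_last//; lra.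
Qed.

Lemma sweep_base t z : 0 <= t <= 1 -> [\/ a = point, s = 0 | s = 1] ->
  sweep a s y t z = sweep0 y t z.
Proof.
move=> t01 base; rewrite /sweep /sweep0 /cat2; case: ifP => _;
  last exact: base_exit.
have eE := base_exit ^~ base.
case: base eE => e eE; rewrite /track.
- have ek : kl a = point by rewrite e ptmap_point.
  case: ifPn => s2; rewrite -?ltNge in s2; apply: eq_spur => // r _;
    rewrite ?ek//.
  by rewrite -eE (min_idPr _)//; lra.
- rewrite e mulr0 ler0n (min_idPl ler01); apply: eq_spur => // r _.
  + by rewrite mul0r !mulr0 addr0 loop_at_le0.
  + by rewrite !mulr0 addr0 loop_at_le0.
  + by rewrite -eE e mulr0 (min_idPl ler01).
- rewrite e ifF; last by apply/negbTE; rewrite -ltNge; lra.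
  have -> : Num.max 0 (Num.min (4 - 4 * 1) (2 - 2 * psi a) - 1) = 0.
    have /andP[p0 p1] := psi01 a.
    by apply/max_idPl; rewrite (min_idPl _); lra.
  apply: eq_spur => // r _.
  + by rewrite mul0r mulr0 subr0 loop_at_ge1.
  + by rewrite mul0r mulr0 subr0 loop_at_ge1.
  + by rewrite -eE e (min_idPr _)//; lra.
Qed.
End values.

Lemma exit0_point r : exit0 (point : G1) r = point.
Proof. by rewrite /exit0 /cat2; case: ifP => // _; rewrite ptmap_point. Qed.

Lemma fill0_point t : fill0 (point : G1) t = point.
Proof.
rewrite /fill0 /omega /cat2; case: ifP => _;
  first by rewrite susp_at_point vert_point.
rewrite (_ : to_loop _ = point) ?susp_at_point ?vert_point//.
by apply: to_loop_eq => r _; rewrite /chain /cat2; case: ifP => // _;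
  rewrite exit0_point.
Qed.

Lemma sweep0_point t z : sweep0 (point : G1) t z = point.
Proof.
rewrite /sweep0 /cat2; case: ifP => _; last exact: exit0_point.
by rewrite /spur /cat2; do 2 case: ifP => // _; rewrite exit0_point.
Qed.

Lemma slide0_point z : slide0 (point : G1) z = point.
Proof. by rewrite /slide0 /cat2; case: ifP => // _; rewrite exit0_point. Qed.
End sweep.

(** * From the second Ganea space to the realization *)

Section from_ganea.
Variables (R : realType) (X : ptopologicalType).
Notation I := (unit_interval R).
Notation SX := (susp_loop R X).
Notation G1 := (path_space R (ev R X)).
Notation p1 := (path_fibration R (ev R X)).
Notation M := (mapping_cone R (fibre_incl p1)).
Notation L1 := (realization R (Lambda R X) 1).
Notation T := (loop R X * I)%type.
Hypothesis wX : weak_hausdorff X.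

(** Suspension coordinates of the point of [Sigma Omega X] underlying [y],
    chosen arbitrarily in its class. *)
Definition coord_loop (y : G1) : loop R X :=
  (repr (ps_pt y : quo (pinch (@susp_base R (loop R X)))) : T).1.
Definition coord_time (y : G1) : R :=
  unit_val (repr (ps_pt y : quo (pinch (@susp_base R (loop R X)))) : T).2.

Lemma coord_time_bound y : 0 <= coord_time y <= 1.
Proof. by rewrite unit_val_ge0 unit_val_le1. Qed.

Lemma ps_pt_coord y : ps_pt y = susp_at (coord_loop y) (coord_time y).
Proof.
rewrite /coord_loop /coord_time /susp_at unit_valK -surjective_pairing.
by rewrite [RHS]reprK.
Qed.

Lemma ps_at_coord y : ps_at y 0 = loop_at (coord_loop y) (coord_time y).
Proof. by rewrite ps_at0// ps_pt_coord ev_susp_at. Qed.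

Lemma susp_base_coord (p : T) : susp_base p ->
  [\/ p.1 = point, unit_val p.2 = 0 | unit_val p.2 = 1].
Proof.
by case=> ->; rewrite ?unit_val0 ?unit_val1;
  [exact: Or31|exact: Or32|exact: Or33].
Qed.

Lemma coord_point :
  [\/ coord_loop point = point, coord_time point = 0 | coord_time point = 1].
Proof.
apply: susp_base_coord.
have : quo_pi (pinch (@susp_base R (loop R X))) (repr (point : SX)) = quo_pi _
  point.
  by rewrite /quo_pi reprK.
by move=> /quo_pinchP [->|[]//]; exact: Or31.
Qed.

(** The descent lemma for the suspension: maps on the fibre can be given by
    formulas in a loop and a time, as long as the collapsed part of the cylinder
    is treated consistently. *)
Lemma in_coordinates_continuous (S Z : topologicalType) (y : S -> G1)
    (F : loop R X -> R -> S -> Z) (F0 : S -> Z) :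
  k_space S -> continuous y ->
  (forall a s x, 0 <= s <= 1 -> ps_at (y x) 0 = loop_at a s ->
     [\/ a = point, s = 0 | s = 1] -> F a s x = F0 x) ->
  (forall (V : topologicalType) (a : V -> loop R X) (s : V -> R) (f : V -> S),
     k_space V -> continuous a -> continuous s -> continuous f ->
     (forall v, 0 <= s v <= 1) ->
     (forall v, ps_at (y (f v)) 0 = loop_at (a v) (s v)) ->
     continuous (fun v => F (a v) (s v) (f v))) ->
  continuous (fun x => F (coord_loop (y x)) (coord_time (y x)) x).
Proof.
move=> kS cy FF0 cF.
apply: (@quo_descent_continuous X S Z T (pinch (@susp_base R (loop R X)))
  (ev R X)
  (fun x => ps_pt (y x)) (fun x => ps_at (y x) 0)
    (fun t x => F t.1 (unit_val t.2) x)) => //.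
- by apply: k_space_prodI; exact: k_space_loop.
- exact: ptmap_continuous.
- by apply: (comp_continuous (@ps_pt_continuous R _ _ (ev R X))).
- by apply: ps_at_continuous => //; exact: const_continuous.
- by move=> x; rewrite ps_at0.
- move=> t t' x tt' et.
  have u01 (i : I) : 0 <= unit_val i <= 1 by rewrite unit_val_ge0 unit_val_le1.
  have evt (p : T) : ev R X (quo_pi _ p) = loop_at p.1 (unit_val p.2).
    by case: p => w i; rewrite -ev_susp_at /susp_at unit_valK.
  have et' := et; rewrite tt' evt in et'; rewrite evt in et.
  have [->//|[/susp_base_coord bt /susp_base_coord bt']] := quo_pinchP tt'.
  by rewrite (FF0 _ _ x _ _ bt)// (FF0 _ _ x _ _ bt').
- move=> V b f cV cb cf ebf;
  apply: (cF V (fun v => (b v).1) (fun v => unit_val (b v).2) f) => //.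
  + exact: k_space_compact_hausdorff.
  + by continuity.
  + by continuity.
  + by move=> v; rewrite unit_val_ge0 unit_val_le1.
  + move=> v; rewrite -ebf; have := ev_susp_at (b v).1 (unit_val (b v).2).
    by rewrite /susp_at unit_valK -surjective_pairing => <-.
Qed.

Variables (k : ptmap X X) (psi : loop R X -> R).
Hypothesis cpsi : continuous psi.
Hypothesis psi01 : forall w, 0 <= psi w <= 1.
Hypothesis psi_point : psi point = 1.
Hypothesis psik : forall w, 0 < psi w -> loop_map R k w = point.
Notation kl := (loop_map R k).

Let kG1 : k_space G1. Proof. exact: k_space_kify. Qed.
Let kF1 : k_space (fibre p1). Proof. exact: k_space_kify. Qed.
Let u01 (i : I) : 0 <= unit_val i <= 1.
Proof. by rewrite unit_val_ge0 unit_val_le1. Qed.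

Lemma fibre_end (y : fibre p1) : ps_at (fibre_incl p1 y) 1 = point.
Proof. by rewrite ps_at1// fibre_inclP. Qed.

(** The factor 4 matches the first quarter of [fill]. *)
Definition ganea1_fun (y : G1) : L1 :=
    vert (susp_at (kl (coord_loop y)) (4 * coord_time y)).

Lemma ganea1_continuous : continuous ganea1_fun.
Proof.
apply: (@in_coordinates_continuous G1 L1 (fun y => y)
  (fun a s _ => vert (susp_at (kl a) (4 * s))) (fun=> point)) => //.
- by move=> ?; exact: cvg_id.
- move=> a s y s01 _ [->|->|->].
  + by rewrite ptmap_point susp_at_point vert_point.
  + by rewrite susp_at_le0 ?vert_point// mulr0.
  + by rewrite susp_at_ge1 ?vert_point//; lra.
- move=> V a s f kV ca cs cf s01 _.
  apply: (comp_continuous (@vert_continuous R X) (f := fun v => susp_at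
    (kl (a v)) (4 * s v))).
  by apply: susp_at_continuous; [exact: kl_continuous|continuity].
Qed.

Lemma ganea1_point : ganea1_fun point = point.
Proof.
rewrite /ganea1_fun; case: coord_point => ->.
- by rewrite ptmap_point susp_at_point vert_point.
- by rewrite susp_at_le0 ?vert_point// mulr0.
- by rewrite susp_at_ge1 ?vert_point//; lra.
Qed.

Definition ganea1_map : ptmap G1 L1 := PtMap ganea1_continuous ganea1_point.

Definition nullhomotopy_fun (p : fibre p1 * I) : L1 :=
  let y := fibre_incl p1 p.1 in
  fill k psi (coord_loop y) (coord_time y) y (unit_val p.2).

Lemma fibre_incl_fst_continuous :
    continuous (fun p : fibre p1 * I => fibre_incl p1 p.1).
Proof. by apply: comp_continuous (@ptmap_continuous _ _ (fibre_incl p1))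
  (@fst_continuous _ _). Qed.

Lemma nullhomotopy_continuous : continuous nullhomotopy_fun.
Proof.
apply: (@in_coordinates_continuous _ L1 (fun p => fibre_incl p1 p.1)
  (fun a s p => fill k psi a s (fibre_incl p1 p.1) (unit_val p.2))
  (fun p => fill0 k (fibre_incl p1 p.1) (unit_val p.2))).
- exact: k_space_prodI.
- exact: fibre_incl_fst_continuous.
- by move=> a s p s01 e base; apply: fill_base => //; exact: fibre_end.
- move=> V a s f kV ca cs cf s01 e; apply: fill_continuous => //.
  + by continuity.
  + by apply: (comp_continuous fibre_incl_fst_continuous).
  + by move=> v; exact: fibre_end.
Qed.

Lemma nullhomotopy_cone p : cone_base p -> nullhomotopy_fun p = point.
Proof.
case: p => y t [/= ->|/= ->]; rewrite /nullhomotopy_fun;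
  last by rewrite fill_end.
rewrite [fibre_incl p1 _](ptmap_point (fibre_incl p1)) fill_base
  ?coord_time_bound//; last exact: coord_point.
  exact: fill0_point.
exact: ps_at_coord.
Qed.

Let cone_base_point : cone_base (point : fibre p1 * I).
Proof. by left. Qed.

Definition nullhomotopy : ptmap (fibre p1 * I)%type L1 :=
  PtMap nullhomotopy_continuous (nullhomotopy_cone cone_base_point).

Lemma nullhomotopy_pinch p q : pinch (@cone_base R (fibre p1)) p q ->
    nullhomotopy p = nullhomotopy q.
Proof. by move=> [bp bq]; rewrite /= !nullhomotopy_cone. Qed.

Definition nullhomotopy_map : ptmap (cone R (fibre p1)) L1 :=
    quo_lift nullhomotopy_pinch.

Lemma nullhomotopy_attach y c : attach (fibre_incl p1) y c ->
    ganea1_map y = nullhomotopy_map c.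
Proof.
move=> [x [-> ->]].
have -> : nullhomotopy_map (cone_pi R (fibre p1) (x, zero)) = nullhomotopy
  (x, zero).
  exact: (quo_liftE nullhomotopy_pinch (x, zero)).
by rewrite /= /nullhomotopy_fun /= unit_val0 fill_start.
Qed.

Definition from_cone : ptmap M L1 := glue_lift nullhomotopy_attach.

Lemma from_cone_left y : from_cone (cone_left y) = ganea1_fun y.
Proof. exact: (glue_lift_leftE nullhomotopy_attach y). Qed.

Lemma from_cone_right y t :
    from_cone (cone_right y t) = nullhomotopy_fun (y, clamp t).
Proof.
have := glue_lift_rightE (attach_point R (fibre_incl p1)) nullhomotopy_attach
  (cone_pi R (fibre p1) (y, clamp t)).
by move=> e; rewrite [LHS]e; exact: (quo_liftE nullhomotopy_pinch (y, clamp t)).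
Qed.

Notation PX := (path_space R (id_map X)).

Lemma slide_joint_continuous : continuous (fun p : G1 * I =>
  slide k (coord_loop p.1) (coord_time p.1) p.1 (unit_val p.2)).
Proof.
apply: (@in_coordinates_continuous (G1 * I)%type X fst (fun a s p => slide k a s
  p.1 (unit_val p.2))
  (fun p => slide0 k p.1 (unit_val p.2))).
- exact: k_space_prodI.
- exact: fst_continuous.
- by move=> a s p s01 e base; exact: slide_base.
- by move=> V a s f kV ca cs cf s01 e; apply: slide_continuous => //;
  continuity.
Qed.

Lemma sweep_joint_continuous : continuous (fun p : (fibre p1 * I) * I =>
  let y := fibre_incl p1 p.1.1 in
  sweep k psi (coord_loop y) (coord_time y) y (unit_val p.1.2) (unit_val p.2)).
Proof.
apply: (@in_coordinates_continuous ((fibre p1 * I) * I)%type X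
  (fun p => fibre_incl p1 p.1.1)
  (fun a s p => sweep k psi a s (fibre_incl p1 p.1.1) (unit_val p.1.2)
    (unit_val p.2))
  (fun p => sweep0 k (fibre_incl p1 p.1.1) (unit_val p.1.2) (unit_val p.2))).
- by do 2 apply: k_space_prodI.
- exact: comp_continuous fibre_incl_fst_continuous (@fst_continuous _ _).
- by move=> a s p s01 e base; apply: sweep_base => //; exact: fibre_end.
- move=> V a s f kV ca cs cf s01 e; apply: sweep_continuous => //;
  try by continuity.
  apply: (comp_continuous fibre_incl_fst_continuous (f := fun v => (f v).1)).
  by continuity.
Qed.

(** The homotopy is assembled as a map into the space of all paths in [X], so
    that it can be glued over the mapping cone like any other map. *)
Definition slide_fun (y : G1) : PX :=
  to_path (id_map X) (slide k (coord_loop y) (coord_time y) y 0)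
    (slide k (coord_loop y) (coord_time y) y).

Lemma slide_fun_continuous : continuous slide_fun.
Proof.
apply: (to_path_continuous (f := id_map X)) => //;
  last exact: slide_joint_continuous.
by apply: (comp_continuous slide_joint_continuous (f := fun y => (y, zero)));
  continuity.
Qed.

Lemma slide_point r : slide k (coord_loop point) (coord_time point)
    point r = point.
Proof. by rewrite slide_base ?slide0_point//; exact: coord_point. Qed.

Lemma slide_fun_point : slide_fun point = point.
Proof. by apply: eq_to_path => [|r _]; rewrite slide_point. Qed.

Lemma slide_fun_at y r : 0 <= r <= 1 ->
    ps_at (slide_fun y) r = slide k (coord_loop y) (coord_time y) y r.
Proof.
apply: to_path_at; split=> //.
by apply: (comp_continuous slide_joint_continuous (f := fun t => (y, t)));
  continuity.
Qed.

Definition slide_map : ptmap G1 PX :=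
    PtMap slide_fun_continuous slide_fun_point.

Definition sweep_fun (p : fibre p1 * I) : PX :=
  let y := fibre_incl p1 p.1 in
  let w := sweep k psi (coord_loop y) (coord_time y) y (unit_val p.2) in
  to_path (id_map X) (w 0) w.

Lemma sweep_fun_continuous : continuous sweep_fun.
Proof.
apply: (to_path_continuous (f := id_map X)) => //;
  last exact: sweep_joint_continuous.
  exact: k_space_prodI.
by apply: (comp_continuous sweep_joint_continuous (f := fun y => (y, zero)));
  continuity.
Qed.

Lemma sweep_fun_at p r : 0 <= r <= 1 -> let y := fibre_incl p1 p.1 in
  ps_at (sweep_fun p) r = sweep k psi (coord_loop y) (coord_time y)
    y (unit_val p.2) r.
Proof.
apply: to_path_at; split=> //.
by apply: (comp_continuous sweep_joint_continuous (f := fun t => (p, t)));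
  continuity.
Qed.

Lemma sweep_fun_cone p : cone_base p -> sweep_fun p = point.
Proof.
case: p => y t bp.
have e r : 0 <= r <= 1 -> sweep k psi (coord_loop (fibre_incl p1 y))
  (coord_time (fibre_incl p1 y)) (fibre_incl p1 y) (unit_val t) r = point.
  move=> r01; case: bp => bp; rewrite /= in bp; rewrite bp; last first.
    by rewrite unit_val1 sweep_end//; exact: fibre_end.
  rewrite [fibre_incl p1 _](ptmap_point (fibre_incl p1)) sweep_base//;
    [exact: sweep0_point|exact: coord_point].
by apply: eq_to_path => //; rewrite e// lexx ler01.
Qed.

Definition sweep_ptmap : ptmap (fibre p1 * I)%type PX :=
  PtMap sweep_fun_continuous (sweep_fun_cone cone_base_point).

Lemma sweep_pinch p q : pinch (@cone_base R (fibre p1)) p q ->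
    sweep_ptmap p = sweep_ptmap q.
Proof. by move=> [bp bq]; rewrite /= !sweep_fun_cone. Qed.

Definition sweep_map : ptmap (cone R (fibre p1)) PX :=
  quo_lift sweep_pinch.

Lemma sweep_attach y c : attach (fibre_incl p1) y c ->
    slide_map y = sweep_map c.
Proof.
move=> [x [-> ->]].
have -> : sweep_map (cone_pi R (fibre p1) (x, zero)) = sweep_fun (x, zero).
  exact: (quo_liftE sweep_pinch (x, zero)).
have e z : 0 <= z <= 1 -> sweep k psi (coord_loop (fibre_incl p1 x))
  (coord_time (fibre_incl p1 x)) (fibre_incl p1 x) (unit_val zero) z =
    slide k (coord_loop (fibre_incl p1 x)) (coord_time (fibre_incl p1 x))
      (fibre_incl p1 x) z.
  by move=> z01; rewrite unit_val0 sweep_start.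
apply/esym/eq_to_path; first by rewrite e ?lexx ?ler01.
by move=> r r01; rewrite e// slide_fun_at.
Qed.

Definition homotopy_map : ptmap M PX := glue_lift sweep_attach.

Lemma homotopy_map_left y : homotopy_map (cone_left y) = slide_fun y.
Proof. exact: (glue_lift_leftE sweep_attach y). Qed.

Lemma homotopy_map_right y t :
    homotopy_map (cone_right y t) = sweep_fun (y, clamp t).
Proof.
have := glue_lift_rightE (attach_point R (fibre_incl p1)) sweep_attach
  (cone_pi R (fibre p1) (y, clamp t)).
by move=> e; rewrite [LHS]e; exact: (quo_liftE sweep_pinch (y, clamp t)).
Qed.

Lemma cone_cases (m : M) : (exists y, m = cone_left y) \/ exists y t,
    m = cone_right y t.
Proof.
have [[[] x] ->] := quo_surj m; first by left; exists x.
have [[y t] ->] := quo_surj x; right; exists y, (unit_val t).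
by rewrite /cone_right unit_valK.
Qed.

(** The homotopy is [slide] on [G_1] and [sweep] on the cone. They end at [k] of
    the end of the path and at the base point, which is the projection of the
    mapping cone followed by [k]. *)
Lemma from_cone_homotopic :
  homotopic R (ptcomp (canonical_map R (Lambda R X) 1) from_cone)
    (ptcomp k (ganea_cone R p1)).
Proof.
exists (fun p => ps_at (homotopy_map p.1) (unit_val p.2)); split=> [|m|m|t].
- apply: (ps_at_continuous (y := fun p : M * I => homotopy_map p.1));
  last by continuity.
  by apply: comp_continuous (@ptmap_continuous _ _ homotopy_map)
    (@fst_continuous _ _).
- change (ps_at (homotopy_map m) (unit_val zero) = canonical_map R (Lambda R X)
  1 (from_cone m)).
  rewrite unit_val0; have [[y ->]|[y [t ->]]] := cone_cases m.
    rewrite homotopy_map_left from_cone_left slide_fun_at ?lexx ?ler01//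
      slide_first.
    by rewrite canonical_vert ev_susp_at.
  rewrite homotopy_map_right from_cone_right sweep_fun_at ?lexx ?ler01//.
  rewrite -canonical_fill//; [exact: ps_at_coord|exact: fibre_end].
- change (ps_at (homotopy_map m) (unit_val one) = k (ganea_cone R p1 m)).
  rewrite unit_val1; have [[y ->]|[y [t ->]]] := cone_cases m.
    rewrite homotopy_map_left slide_fun_at ?lexx ?ler01// slide_last.
    by rewrite ganea_cone_left ps_at1.
  rewrite homotopy_map_right ganea_cone_right sweep_fun_at ?lexx ?ler01//
    ptmap_point.
  by rewrite sweep_last//; exact: fibre_end.
- change (ps_at (homotopy_map point) (unit_val t) = point).
  by rewrite ptmap_point.
Qed.

End from_ganea.

Lemma path_fibration_homotopic (R : realType) (A X : ptopologicalType)
    (f : ptmap A X) :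
  exists pr : ptmap (path_space R f) A,
    homotopic R (ptcomp f pr) (path_fibration R f).
Proof.
exists (PtMap (@ps_pt_continuous R _ _ f) (ps_pt_point R f)).
exists (fun p => ps_at p.1 (unit_val p.2)); split=> [|y|y|t] //.
- by apply: (ps_at_continuous (y := fst)); continuity.
- by rewrite ps_at0.
- by rewrite ps_at1.
Qed.

Theorem theorem2 (R : realType) (X : ptopologicalType) (hX : in_Top R X) :
  (exists f : ptmap (realization R (Lambda R X) 1) (ganea R X 2),
     homotopic R (ptcomp (ganea_map R X 2) f) (canonical_map R (Lambda R X) 1))
       /\
  (exists g : ptmap (ganea R X 2) (realization R (Lambda R X) 1),
     homotopic R (ptcomp (canonical_map R (Lambda R X) 1) g) (ganea_map R X 2)).
Proof.
have [wpX [_ wX] _] := hX; split.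
  by have [f fE] := realization_to_ganea R X; exists f; exact: homotopic_ext.
have [k [psi [hk cpsi psi01 psip psik]]] := well_pointed_loop wpX.
have [pr hpr] := path_fibration_homotopic R (ganea_cone R (path_fibration
  R (ev R X))).
exists (ptcomp (from_cone wX cpsi psi01 psip psik) pr).
apply: homotopic_trans hpr.
have h1 := homotopic_precomp pr (from_cone_homotopic wX cpsi psi01 psip psik).
have h2 := homotopic_precomp pr (homotopic_precomp
  (ganea_cone R (path_fibration R (ev R X))) (homotopic_sym hk)).
exact: homotopic_trans h1 h2.
Qed.
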